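(* For each $n$ let $\delta$ be a uniformly random transition function of an automaton with state set $[n]$ and alphabet $\{a,b\}$. Then, with probability $1-o(1)$ as $n\to\infty$, the following holds: for all pairs of states $x,y\in[n]$ there exists a word $\omega=\omega^{xy}\in\{a,b\}^*$ of length at most $3\log_2 n$ such that $\delta_\omega(x)=\delta_\omega(y)$.
   Context: $[n]=\{1,\dots,n\}$. A random automaton on state set $[n]$ with alphabet $\{a,b\}$ is given by a transition function $\delta:[n]\times\{a,b\}\to[n]$ chosen uniformly among all $n^{2n}$ such functions; equivalently, the values $\delta_c(x):=\delta(x,c)$, for $x\in[n]$, $c\in\{a,b\}$, are independent and uniform on $[n]$. For a word $\omega=\omega_1\omega_2\cdots\omega_m\in\{a,b\}^*$ put $\delta_\omega:=\delta_{\omega_m}\circ\cdots\circ\delta_{\omega_1}$ (the empty word gives the identity). *)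

(* Defs.v *)
From HB Require Import structures.
From mathcomp Require Import all_boot all_order all_algebra.
From mathcomp Require Import all_classical all_reals all_analysis.

Set Implicit Arguments.
Unset Strict Implicit.
Unset Printing Implicit Defensive.

Import Order.TTheory GRing.Theory Num.Theory.
Import numFieldNormedType.Exports.

Local Open Scope ring_scope.

(* The two-letter alphabet {a, b}: a is [false], b is [true]. *)
Definition letter : finType := bool.

Definition word : Type := seq letter.

(* The state set [n] = {1, ..., n} is represented by 'I_n = {0, ..., n-1}. *)
Definition automaton (n : nat) : finType := {ffun 'I_n * letter -> 'I_n}.

(* Letters are read from left to right:
   delta_(w1 ... wm) = delta_wm \o ... \o delta_w1. *)
Definition run (n : nat) (delta : automaton n) (w : word) (x : 'I_n) : 'I_n :=
  foldl (fun y c => delta (y, c)) x w.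

Definition prob_uniform_fin (R : realType) (T : finType) (E : T -> Prop) : R :=
  #|[pred t : T | `[< E t >]]|%:R / #|T|%:R.

Definition log2 (R : realType) (x : R) : R := ln x / ln 2.

(* Main.v *)
(** Write [L] for the integer part of [log2 n] and [l] for [log2 L + 1].

    Backward: let [u] range over the words of length [10 l] and append [a^L] to each.
    The image of [a^L] has only [O(n / L)] states with high probability, since
    the backward tree of a state under a random map has height at least [k] with
    probability about [1 / k]. By Cauchy-Schwarz each word [u a^L] then merges at
    least [l^6 n] pairs of states. A pair is rarely merged late by two words at
    once, because that takes two independent collisions, so that some
    [2^(10 l) n] pairs in all are synchronised by words [u a^L], even along paths
    avoiding any prescribed set of [O(2^L / 2^(7 l))] states.

    Forward: with high probability no set of bounded size has fewer than twice
    its size of states in its out-neighbourhood, so that from any two states at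
    most two arrows are lost in a bounded neighbourhood, and a word of length at
    most [3] either merges them or leads to a pair whose joint exploration tree
    has no collision down to depth [5]. From there exponential moment bounds,
    strong enough for a union bound over all pairs, show that at depth
    [L - 7 l] a positive proportion of the words lead to pairs of new states. One
    more letter sends each of them to a fresh uniform pair, and the backward part
    only depends on the arrows out of the other states, so that one of these
    [~ 2^(L - 7 l)] trials hits a set of [2^(10 l) n] pairs. The total
    length is at most [3 + (L - 7 l) + 1 + 10 l + L <= 3 L]. *)

Require Import Defs.
From HB Require Import structures.
From mathcomp Require Import all_boot all_order all_algebra.
From mathcomp Require Import all_classical all_reals all_analysis.
From mathcomp Require Import ring lra zify.

Set Implicit Arguments.
Unset Strict Implicit.
Unset Printing Implicit Defensive.

Import Order.TTheory GRing.Theory Num.Theory.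
Import numFieldNormedType.Exports.

Local Open Scope ring_scope.

(** * Averages over finite types and resampling *)

(** The backward events may fail with probability of order [1 / l], far too much for a union bound
    over the [n ^ 2] pairs or over the sets explored from them. They are therefore events on the
    automaton alone, and [synced_large] draws from them a deterministic conclusion, valid at once
    for every avoided set [D] of bounded size. Only the forward part pays the union bound, each of
    its events failing with probability at most [2 ^ -(3 L + 2)] for a given pair. Conditioning is
    replaced throughout by resampling: arrows not read so far are exchanged with those of an
    independent copy.

    The constants balance as follows. About [2 ^ (L - 7 l)] trials at density [2 ^ (10 l) / n] give
    some [2 ^ (3 l)] expected hits, well above [3 L]. The depth [L - 7 l] keeps the explored set
    small enough that few backward walks meet it; as a small set may have huge preimages, this needs
    a separate count of the pairs merged along the way. Finally [l ^ 6] exceeds the number of early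
    merges, of order [l ^ 2] and allowed up to [l ^ 3], and is still negligible against [L], the
    factor gained on the image of [a^L]. *)

Section Mean.
Variable R : realType.

Definition Ex (T : finType) (f : T -> R) : R := (\sum_t f t) / #|T|%:R.

Lemma eq_Ex (T : finType) (f g : T -> R) : f =1 g -> Ex f = Ex g.
Proof. by move=> fg; rewrite /Ex (eq_bigr _ (fun t _ => fg t)). Qed.

Lemma le_Ex (T : finType) (f g : T -> R) :
  (forall t, f t <= g t) -> Ex f <= Ex g.
Proof. by move=> fg; rewrite /Ex ler_wpM2r ?invr_ge0// ler_sum. Qed.

Lemma Ex_ge0 (T : finType) (f : T -> R) : (forall t, 0 <= f t) -> 0 <= Ex f.
Proof. by move=> f0; rewrite /Ex divr_ge0// sumr_ge0. Qed.

Lemma ExD (T : finType) (f g : T -> R) :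
  Ex (fun t => f t + g t) = Ex f + Ex g.
Proof. by rewrite /Ex big_split mulrDl. Qed.

Lemma ExZ (T : finType) (c : R) (f : T -> R) :
  Ex (fun t => c * f t) = c * Ex f.
Proof. by rewrite /Ex -mulr_sumr mulrA. Qed.

Lemma ExZr (T : finType) (c : R) (f : T -> R) :
  Ex (fun t => f t * c) = Ex f * c.
Proof. by rewrite mulrC -ExZ; apply: eq_Ex => t; rewrite mulrC. Qed.

Lemma Ex_sum (T : finType) (I : Type) (r : seq I) (P : pred I) (f : I -> T -> R) :
  Ex (fun t => \sum_(i <- r | P i) f i t) = \sum_(i <- r | P i) Ex (f i).
Proof. by rewrite /Ex exchange_big mulr_suml. Qed.

Lemma Ex_cst (T : finType) (c : R) : (0 < #|T|)%N -> Ex (fun _ : T => c) = c.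
Proof.
move=> T0; rewrite /Ex sumr_const -[X in X / _]mulr_natr mulfK//.
by rewrite pnatr_eq0 -lt0n.
Qed.

Definition Pr (T : finType) (E : pred T) : R := Ex (fun t => (E t)%:R).

Lemma PrE (T : finType) (E : pred T) : Pr E = #|E|%:R / #|T|%:R.
Proof.
by rewrite /Pr /Ex -natr_sum -sum1_card [in RHS]big_mkcond.
Qed.

Lemma Pr_ge0 (T : finType) (E : pred T) : 0 <= Pr E.
Proof. by apply: Ex_ge0. Qed.

Lemma le_Pr (T : finType) (E F : pred T) :
  (forall t, E t -> F t) -> Pr E <= Pr F.
Proof.
by move=> EF; apply: le_Ex => t; rewrite ler_nat; case: (E t) (EF t) => // ->.
Qed.

Lemma Pr_le1 (T : finType) (E : pred T) : (0 < #|T|)%N -> Pr E <= 1.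
Proof.
by move=> T0; rewrite -(Ex_cst 1 T0); apply: le_Ex => t; rewrite lern1 leq_b1.
Qed.

Lemma PrU (T : finType) (E F : pred T) :
  Pr (fun t => E t || F t) <= Pr E + Pr F.
Proof.
rewrite -ExD; apply: le_Ex => t; rewrite -natrD ler_nat.
by case: (E t); case: (F t).
Qed.

Lemma Pr_exists (T I : finType) (P : pred I) (E : I -> pred T) :
  Pr (fun t => [exists i, P i && E i t]) <= \sum_(i | P i) Pr (E i).
Proof.
rewrite -Ex_sum; apply: le_Ex => t; case: existsP => [[i /andP[Pi Ei]]|_].
  rewrite (bigD1 i)//= Ei lerDl; exact: sumr_ge0.
exact: sumr_ge0.
Qed.

Lemma Pr_has (T : finType) (I : eqType) (s : seq I) (E : I -> pred T) :
  Pr (fun t => has (fun i => E i t) s) <= \sum_(i <- s) Pr (E i).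
Proof.
elim: s => [|i s ih]; first by rewrite big_nil /Pr /Ex big1// mul0r.
by rewrite big_cons; apply: le_trans (PrU _ _) _; rewrite lerD2l.
Qed.

Lemma markov_Ex (T : finType) (f : T -> R) (E : pred T) (a : R) :
  0 < a -> (forall t, 0 <= f t) -> (forall t, E t -> a <= f t) ->
  Pr E <= Ex f / a.
Proof.
move=> a0 f0 Ef; rewrite ler_pdivlMr// -ExZr; apply: le_Ex => t.
by case: (boolP (E t)) => [/Ef|]; rewrite ?mul1r ?mul0r.
Qed.

End Mean.

Section Resampling.
Variables (R : realType) (A V : finType).
Implicit Types (d h : {ffun A -> V}) (Q : pred A).

(** Stands in for conditioning on the values off [Q]: these are kept, the others are redrawn from
    [h]. *)
Definition mix Q d h : {ffun A -> V} := [ffun e => if Q e then h e else d e].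

(* Exchanging the values of [d] and of an independent copy [h] on [Q d] is an
   involution of the pairs, because [Q d] does not depend on those values. *)
Lemma Ex_mix (Q : {ffun A -> V} -> pred A) (f : {ffun A -> V} -> R) :
  (forall d h, Q (mix (Q d) d h) =1 Q d) ->
  Ex f = Ex (fun d => Ex (fun h => f (mix (Q d) d h))).
Proof.
move=> Qst; have [T0|] := posnP #|{ffun A -> V}|.
  by rewrite {1 2}/Ex T0 invr0 !mulr0.
move=> T0; pose sw (z : {ffun A -> V} * {ffun A -> V}) :=
  (mix (Q z.1) z.1 z.2, mix (Q z.1) z.2 z.1).
have swK : involutive sw.
  move=> [d h]; rewrite /sw /=; congr pair; apply/ffunP => e;
    rewrite !ffunE Qst; by case: (Q d e).
transitivity (Ex (fun d => Ex (fun _ : {ffun A -> V} => f d))).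
  by apply: eq_Ex => d; rewrite Ex_cst.
rewrite /Ex -!mulr_suml !pair_bigA /=; congr (_ / _ / _).
rewrite (reindex_inj (inv_inj swK)) /=.
by apply: eq_bigr => -[d h] _.
Qed.

Lemma mixl Q d h e : Q e -> mix Q d h e = h e.
Proof. by rewrite ffunE => ->. Qed.

Lemma mixr Q d h e : ~~ Q e -> mix Q d h e = d e.
Proof. by rewrite ffunE => /negPf->. Qed.

Lemma Ex_coord (e : A) (g : V -> R) : (0 < #|V|)%N ->
  Ex (fun h : {ffun A -> V} => g (h e)) = Ex g.
Proof.
move=> V0; rewrite /Ex (partition_big (fun h : {ffun A -> V} => h e) predT)//=.
have cE v : #|[pred h : {ffun A -> V} | h e == v]| = (#|V| ^ #|A|.-1)%N.
  pose F i := [pred w : V | (i == e) ==> (w == v)].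
  have -> : #|[pred h : {ffun A -> V} | h e == v]| = #|family F|.
    apply: eq_card => h; rewrite !inE; apply/eqP/familyP => [he i|/(_ e)].
      by rewrite inE; apply/implyP => /eqP->; rewrite he.
    by rewrite inE eqxx => /eqP.
  rewrite card_family foldrE big_map big_enum /= (bigD1 e)//=.
  rewrite (eq_card (B := pred1 v)); last by move=> w; rewrite !inE eqxx.
  rewrite card1 mul1n -(cardC1 e) -prod_nat_const.
  apply: eq_bigr => i /negPf ie.
  by apply: eq_card => w; rewrite !inE ie.
under eq_bigr => v _.
  rewrite (eq_bigr (fun=> g v)); last by move=> h /eqP->.
  rewrite sumr_const cE; over.
rewrite sumrMnl -[X in X / _]mulr_natr card_ffun.
have A0 : (0 < #|A|)%N by apply/card_gt0P; exists e.
rewrite -{2}(prednK A0) expnS natrM invfM mulrACA divff ?mulr1//.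
by rewrite pnatr_eq0 expn_eq0 negb_and -lt0n V0.
Qed.

(* The arrow [e d] has not been looked at by [e], [G] and [W]. *)
Lemma Pr_fresh (e : {ffun A -> V} -> A) (G : pred {ffun A -> V})
    (W : {ffun A -> V} -> seq V) (w : nat) :
  (0 < #|V|)%N ->
  (forall d h, G d -> e (mix (pred1 (e d)) d h) = e d) ->
  (forall d h, G d -> G (mix (pred1 (e d)) d h)) ->
  (forall d h, G d -> W (mix (pred1 (e d)) d h) =i W d) ->
  (forall d, G d -> (size (W d) <= w)%N) ->
  Pr R (fun d => G d && (d (e d) \in W d)) <= w%:R / #|V|%:R * Pr R G.
Proof.
move=> V0 est Gst Wst Ww; rewrite /Pr -ExZ.
(* Nothing is resampled outside [G], where the stability hypotheses say nothing. *)
pose Q d : pred A := if G d then pred1 (e d) else pred0.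
have Qst d h : Q (mix (Q d) d h) =1 Q d.
  rewrite /Q; case: (boolP (G d)) => Gd x; first by rewrite Gst// est.
  by rewrite (_ : mix _ d h = d) ?(negPf Gd)//; apply/ffunP => y; rewrite ffunE.
rewrite (Ex_mix _ Qst); apply: le_Ex => d; rewrite /Q.
case: (boolP (G d)) => Gd; last first.
  rewrite mulr0 (eq_Ex (g := fun=> 0)) ?/Ex ?big1 ?mul0r//.
  move=> h; rewrite (_ : mix _ d h = d) ?(negPf Gd)//.
  by apply/ffunP => y; rewrite ffunE.
rewrite mulr1 (eq_Ex (g := fun h : {ffun A -> V} => (h (e d) \in W d)%:R)); last first.
  by move=> h; rewrite Gst// est// Wst// mixl//= eqxx.
rewrite (Ex_coord (e d) (fun v => (v \in W d)%:R))// /Ex ler_wpM2r ?invr_ge0//.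
rewrite -natr_sum ler_nat; apply: leq_trans (Ww d Gd).
have -> : (\sum_v (v \in W d) = #|W d|)%N.
  by rewrite -sum1_card [RHS]big_mkcond; apply: eq_bigr => v _; case: ifP.
exact: card_size.
Qed.

End Resampling.

(** * Collisions along walks *)

Section Walks.
Variable n : nat.
Notation V := 'I_n.
Notation arrow := (V * letter)%type.
Implicit Types (d : automaton n) (w : word) (x : V).

Fixpoint walk d x w : seq arrow :=
  if w is c :: w' then (x, c) :: walk d (d (x, c)) w' else [::].

Lemma size_walk d x w : size (walk d x w) = size w.
Proof. by elim: w x => //= c w ih x; rewrite ih. Qed.

Lemma run_cat d x w w' : run d (w ++ w') x = run d w' (run d w x).
Proof. by rewrite /run foldl_cat. Qed.

Lemma run_rcons d x w c : run d (rcons w c) x = d (run d w x, c).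
Proof. by rewrite -cats1 run_cat. Qed.

Lemma walk_cat d x w w' : walk d x (w ++ w') = walk d x w ++ walk d (run d w x) w'.
Proof. by elim: w x => //= c w ih x; rewrite ih. Qed.

Lemma walk_rcons d x w c : walk d x (rcons w c) = rcons (walk d x w) (run d w x, c).
Proof. by rewrite -!cats1 walk_cat. Qed.

Lemma take_walk d x w i : take i (walk d x w) = walk d x (take i w).
Proof. by elim: w i x => [|c w ih] [|i] x //=; rewrite ih. Qed.

Lemma nth_walk d x w i e0 : (i < size w)%N ->
  nth e0 (walk d x w) i = (run d (take i w) x, nth e0.2 w i).
Proof. by elim: w i x => [|c w ih] [|i] x //= iw; rewrite ih. Qed.

Lemma eq_run d d' x w : {in walk d x w, d =1 d'} -> run d' w x = run d w x.
Proof.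
elim: w x => //= c w ih x dd'; rewrite /run /= -dd' ?mem_head//.
by apply: ih => e ew; rewrite dd'// inE ew orbT.
Qed.

(** Arrows with distinct targets off the roots form a forest, where the path to a state is unique:
    compare the walks from their last letters. Only the first walk must stay in [C0];
    [double_merge_coll] compares walks of which only one is known to avoid the redundant arrows. *)
Lemma walk_inj d (C0 C : pred arrow) (Rt : pred V) r r' w w' :
  (forall g g', C0 g -> C g' -> d g = d g' -> g = g') ->
  (forall g, C0 g -> C g) -> (forall g, C g -> ~~ Rt (d g)) ->
  Rt r -> Rt r' -> all C0 (walk d r w) -> all C (walk d r' w') ->
  run d w r = run d w' r' -> r = r' /\ w = w'.
Proof.
move=> dI C0C CRt Rr Rr'; elim/last_ind: w w' => [|w c ih] w'.
  case/lastP: w' => [|w' c] // _; rewrite walk_rcons all_rcons run_rcons /=.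
  by move=> /andP[/CRt/negP + _] rE; rewrite -rE.
rewrite walk_rcons all_rcons run_rcons => /andP[Ce Cw].
case/lastP: w' => [|w' c'] /=.
  by move=> _ rE; have /negP := CRt _ (C0C _ Ce); rewrite rE.
rewrite walk_rcons all_rcons run_rcons => /andP[Ce' Cw'] eE.
have [rE ->] := dI _ _ Ce Ce' eE.
by have [-> ->] := ih _ Cw Cw' rE.
Qed.

(** An adaptive sequence of [m] queries: the next arrow is determined by the answers at the arrows
    queried before it. *)
Definition explores (m : nat) (F : automaton n -> seq arrow) :=
  (forall d, size (F d) = m) /\
  (forall d d' t, {in take t (F d), d =1 d'} -> take t.+1 (F d') = take t.+1 (F d)).

Lemma explores_walk x w : explores (size w) (fun d => walk d x w).
Proof.
split=> [d|d d' t]; first exact: size_walk.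
elim: w x t => //= c w ih x [|t] /= dd'; first by rewrite !take0.
congr cons; rewrite -dd' ?mem_head//.
by apply: ih => e ew; rewrite dd'// inE ew orbT.
Qed.

Lemma explores_cat m m' F G : explores m F -> explores m' G ->
  explores (m + m') (fun d => F d ++ G d).
Proof.
move=> [sF lF] [sG lG]; split=> [d|d d' t dd']; first by rewrite size_cat sF sG.
have [tm|mt] := ltnP t m.
  rewrite !takel_cat ?sF//; apply: lF => e; move: (dd' e).
  by rewrite takel_cat// sF ltnW.
have FE : F d' = F d.
  rewrite -[F d'](take_oversize (n := m.+1)) ?sF// (lF d d') ?take_oversize ?sF// => e eF.
  by apply: dd'; rewrite take_cat sF ltnNge mt mem_cat eF.
rewrite !take_cat FE sF ltnNge leqW//= subSn// (lG d)// => e eG.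
by apply: dd'; rewrite take_cat sF ltnNge mt mem_cat eG orbT.
Qed.

Section Collisions.
Variables (R : realType) (m : nat) (F : automaton n -> seq arrow) (Rt : seq V).
Variable (e0 : arrow).
Hypothesis HF : explores m F.

(** A first query whose answer is an already known state; querying an arrow again does not count. *)
Definition coll (d : automaton n) t :=
  let e := nth e0 (F d) t in
  [&& (t < m)%N, e \notin take t (F d) &
      d e \in Rt ++ [seq d g | g <- take t (F d)]].

(** Given the first [t] queries, a new arrow has a uniform target, and at most [t + size Rt] states
    are known. Since [P] may be anything read off these queries, collisions can be chained. *)
Lemma fresh_coll (P : pred (automaton n)) t :
  (forall d d', {in take t (F d), d =1 d'} -> P d -> P d') -> (t < m)%N ->
  Pr R (fun d => P d && coll d t) <= (t + size Rt)%:R / n%:R * Pr R P.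
Proof.
move=> Ploc tm; have n0 : (0 < #|'I_n|)%N by apply/card_gt0P; exists e0.1.
have [sF lF] := HF.
pose e (d : automaton n) := nth e0 (F d) t.
pose G d := P d && (e d \notin take t (F d)).
pose W (d : automaton n) := Rt ++ [seq d g | g <- take t (F d)].
have agree d h : G d -> {in take t (F d), d =1 mix (pred1 (e d)) d h}.
  move=> /andP[_ eF] g gF; rewrite mixr//=.
  by apply: contraNneq eF => <-.
have takeE d h : G d -> take t.+1 (F (mix (pred1 (e d)) d h)) = take t.+1 (F d).
  by move=> /agree => /(_ h) /lF.
have takeE' d h : G d -> take t (F (mix (pred1 (e d)) d h)) = take t (F d).
  move=> /takeE -/(_ h) /(congr1 (take t)).
  by rewrite !take_takel.
have eE d h : G d -> e (mix (pred1 (e d)) d h) = e d.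
  by move=> /takeE -/(_ h) /(congr1 (nth e0 ^~ t)); rewrite !nth_take.
have -> : Pr R (fun d => P d && coll d t) = Pr R (fun d => G d && (d (e d) \in W d)).
  by apply: eq_Ex => d; rewrite /coll tm /G /W /e /= !andbA.
apply: le_trans (Pr_fresh _ n0 eE _ _ (w := t + size Rt) _) _.
- move=> d h Gd; rewrite {1}/G eE// takeE'//.
  by case/andP: (Gd) => Pd ->; rewrite (Ploc d)//; exact: agree.
- move=> d h Gd; rewrite /W takeE'// => v; rewrite !mem_cat; congr orb.
  by congr (v \in _); apply/eq_in_map => g gF; rewrite -agree.
- by move=> d _; rewrite /W size_cat size_map size_take sF tm addnC.
- rewrite card_ord ler_wpM2l// ?divr_ge0//.
  by apply: le_Pr => d /andP[].
Qed.

Lemma coll1 : (n > 0)%N ->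
  Pr R (fun d => has (coll d) (iota 0 m)) <= (m * (m + size Rt))%:R / n%:R.
Proof.
move=> n0; apply: le_trans (Pr_has _ _ (fun t d => coll d t)) _.
have T0 : (0 < #|{: automaton n}|)%N by rewrite card_ffun card_ord expn_gt0 n0.
have h t : t \in iota 0 m -> Pr R (fun d => coll d t) <= (m + size Rt)%:R / n%:R.
  rewrite mem_iota add0n => tm.
  have := fresh_coll (P := predT) (fun _ _ _ => id) tm.
  rewrite /= => /le_trans; apply.
  apply: (@le_trans _ _ ((t + size Rt)%:R / n%:R * 1)).
    by rewrite ler_wpM2l// ?divr_ge0// Pr_le1.
  by rewrite mulr1 ler_wpM2r ?invr_ge0// ler_nat leq_add2r ltnW.
rewrite big_seq; apply: le_trans (ler_sum _ h) _.
rewrite -big_seq big_const_seq count_predT size_iota iter_addr_0.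
by rewrite natrM -[leLHS]mulr_natl mulrA.
Qed.

Definition coll_twice d :=
  has (fun t' => has (fun t => (t < t')%N && coll d t && coll d t') (iota 0 m)) (iota 0 m).

(** The earlier collision is decided by queries made before the later one, so it can serve as [P] in
    [fresh_coll], and the two bounds multiply. *)
Lemma coll2 : (n > 0)%N ->
  Pr R coll_twice <= ((m * (m + size Rt))%:R / n%:R) ^+ 2.
Proof.
move=> n0.
have T0 : (0 < #|{: automaton n}|)%N by rewrite card_ffun card_ord expn_gt0 n0.
have [sF lF] := HF.
have h t t' : t \in iota 0 m -> t' \in iota 0 m ->
  Pr R (fun d => (t < t')%N && coll d t && coll d t') <= ((m + size Rt)%:R / n%:R) ^+ 2.
  rewrite !mem_iota !add0n => /= tm t'm.
  have [tt'|_] /= := boolP (t < t')%N; last first.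
    by rewrite /Pr /Ex big1// mul0r exprn_ge0// divr_ge0.
  have ub s : (s < m)%N -> (s + size Rt)%:R / n%:R <= (m + size Rt)%:R / n%:R :> R.
    by move=> sm; rewrite ler_wpM2r ?invr_ge0// ler_nat leq_add2r ltnW.
  apply: le_trans (fresh_coll (P := coll ^~ t) _ t'm) _.
    move=> d d' dd'; rewrite /coll => /and3P[_].
    have takeE : take t'.+1 (F d') = take t'.+1 (F d) by apply: (lF d).
    have := congr1 (take t) takeE; rewrite !(take_takel _ (leqW (ltnW tt'))).
    move=> takeE1.
    have := congr1 (nth e0 ^~ t) takeE; rewrite !(nth_take _ (leqW tt')).
    move=> ->; rewrite takeE1 tm => -> /=.
    have -> : [seq d' g | g <- take t (F d)] = [seq d g | g <- take t (F d)].
      apply/eq_in_map => g gF; rewrite -dd'//.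
      by move: gF; rewrite -(take_takel (F d) (ltnW tt')) => /mem_take.
    rewrite -dd'// -(nth_take e0 tt') mem_nth// size_take sF.
    by case: ifP; lia.
  have Pt : Pr R (coll^~ t) <= (m + size Rt)%:R / n%:R.
    apply: le_trans (fresh_coll (P := predT) (fun _ _ _ => id) tm) _.
    apply: (@le_trans _ _ ((t + size Rt)%:R / n%:R * 1)).
      by rewrite ler_wpM2l// ?divr_ge0// Pr_le1.
    by rewrite mulr1 ub.
  by rewrite expr2 ler_pM ?Pr_ge0 ?ub// divr_ge0.
apply: le_trans (Pr_has _ _ (fun t' d => has (fun t => (t < t')%N && coll d t && coll d t') (iota 0 m))) _.
have h' t' : t' \in iota 0 m ->
  Pr R (fun d => has (fun t => (t < t')%N && coll d t && coll d t') (iota 0 m)) <=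
  m%:R * ((m + size Rt)%:R / n%:R) ^+ 2.
  move=> t'm.
  apply: le_trans (Pr_has _ _ (fun t d => (t < t')%N && coll d t && coll d t')) _.
  rewrite big_seq; apply: le_trans (ler_sum _ (fun t tm => h t t' tm t'm)) _.
  by rewrite -big_seq big_const_seq count_predT size_iota iter_addr_0 [leRHS]mulr_natl.
rewrite big_seq; apply: le_trans (ler_sum _ h') _.
rewrite -big_seq big_const_seq count_predT size_iota iter_addr_0.
by rewrite natrM -[leLHS]mulr_natl -[m%:R * _ / _]mulrA [leRHS]exprMn [leLHS]mulrA -expr2.
Qed.

(** Every first query adds a new state, except at a collision; without collisions the explored graph
    is a forest on the roots. *)
Lemma card_coll d : uniq Rt ->
  (size Rt + #|F d| <= #|[pred v | v \in Rt ++ [seq d g | g <- F d]]| +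
     count (coll d) (iota 0 m))%N.
Proof.
move=> uR; have [sF _] := HF.
suff h t : (t <= m)%N -> (size Rt + #|take t (F d)| <=
   #|[pred v | v \in Rt ++ [seq d g | g <- take t (F d)]]| + count (coll d) (iota 0 t))%N.
  by have := h m (leqnn m); rewrite take_oversize ?sF.
elim: t => [_|t ih tm].
  rewrite take0 /= addn0 cats0.
  have -> : #|([::] : seq (V * letter))| = 0%N by apply: eq_card0.
  by rewrite addn0 -(card_uniqP uR) leq_eqVlt; apply/orP; left; apply/eqP/eq_card.
have {}ih := ih (ltnW tm).
set e := nth e0 (F d) t.
have tE : take t.+1 (F d) = rcons (take t (F d)) e by rewrite -take_nth// sF.
have -> : iota 0 t.+1 = iota 0 t ++ [:: t] by rewrite -addn1 iotaD.
rewrite count_cat /= addn0.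
have c1 : #|take t.+1 (F d)| = ((e \notin take t (F d)) + #|take t (F d)|)%N.
  rewrite tE -cardU1; apply: eq_card => g.
  by rewrite mem_rcons !inE.
have c2 : #|[pred v | v \in Rt ++ [seq d g | g <- take t.+1 (F d)]]| =
   ((d e \notin Rt ++ [seq d g | g <- take t (F d)]) +
    #|[pred v | v \in Rt ++ [seq d g | g <- take t (F d)]]|)%N.
  transitivity #|[predU1 d e & [pred v | v \in Rt ++ [seq d g | g <- take t (F d)]]]|.
    apply: eq_card => v; rewrite !inE tE map_rcons -cats1 !mem_cat mem_seq1.
    by do !case: (_ \in _); case: (_ == _).
  by rewrite cardU1.
have -> : coll d t = (e \notin take t (F d)) &&
    (d e \in Rt ++ [seq d g | g <- take t (F d)]) by rewrite /coll tm.
rewrite c1 c2; move: ih; move: #|take t (F d)| #|_| (count _ _) => x y z.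
by case: (e \in take t (F d)); case: (d e \in _) => /=; lia.
Qed.

End Collisions.
End Walks.

Lemma uniq_map_inj (T T' : eqType) (f : T -> T') (s : seq T) :
  uniq (map f s) -> {in s &, injective f}.
Proof.
elim: s => //= x s ih /andP[fx us] a b; rewrite !inE.
move=> /predU1P[->|sa] /predU1P[->|sb] // ab; last exact: ih.
  by move: fx; rewrite ab map_f.
by move: fx; rewrite -ab map_f.
Qed.

Lemma count_lt (P : pred nat) m : (1 < count P (iota 0 m))%N ->
  exists t t', [/\ (t < t')%N, (t' < m)%N, P t & P t'].
Proof.
rewrite -size_filter; have := sorted_filter ltn_trans P (iota_ltn_sorted 0 m).
have fP t : t \in [seq x <- iota 0 m | P x] -> P t && (t < m)%N.
  by rewrite mem_filter mem_iota add0n.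
case: [seq x <- iota 0 m | P x] fP => [|t [|t' s]] //= fP /andP[tt' _] _; exists t, t'.
have /andP[-> _] := fP t (mem_head _ _).
by have /andP[-> ->] : P t' && (t' < m)%N by apply: fP; rewrite !inE eqxx orbT.
Qed.

(** * Collisions forced by merging walks *)

Section Coincidences.
Variables (n : nat) (d : automaton n).
Notation V := 'I_n.
Notation arrow := (V * letter)%type.

(** So many distinct states leave no room for two arrows with one target, nor for an arrow into a
    root. *)
Lemma tight_exploration (Rt : seq V) (C : seq arrow) : uniq Rt ->
  (size Rt + #|C| <= #|[pred v | v \in Rt ++ [seq d g | g <- C]]|)%N ->
  {in C &, injective d} /\ {in C, forall g, d g \notin Rt}.
Proof.
move=> uR le; have um : uniq (Rt ++ [seq d g | g <- undup C]).
  apply/card_uniqP/eqP; rewrite eqn_leq card_size size_cat size_map /=.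
  have -> : size (undup C) = #|C|.
    by rewrite -(card_uniqP (undup_uniq C)); apply: eq_card => g; rewrite mem_undup.
  apply: leq_trans le _; rewrite leq_eqVlt; apply/orP; left; apply/eqP/eq_card => v.
  rewrite !inE !mem_cat; congr orb.
  by apply/mapP/mapP => -[g gC ->]; exists g; rewrite // mem_undup in gC *.
move: um; rewrite cat_uniq uR /= => /andP[/hasPn Rd /uniq_map_inj inj]; split.
  by move=> g g' gC g'C; apply: inj; rewrite mem_undup.
by move=> g gC; apply: Rd; apply: map_f; rewrite mem_undup.
Qed.

Lemma merge_coll p q w e0 : p != q -> run d w p = run d w q ->
  has (coll (size w + size w) (fun d => walk d p w ++ walk d q w) [:: p; q] e0 d)
    (iota 0 (size w + size w)).
Proof.
move=> pq mE; rewrite has_count lt0n; apply: contraNneq pq => c0.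
have := card_coll (Rt := [:: p; q]) e0
  (explores_cat (explores_walk p w) (explores_walk q w)) d.
rewrite c0 addn0 => H; apply/eqP.
have [->//|pq] := eqVneq p q.
have uR : uniq [:: p; q] by rewrite /= inE pq.
have [inj Rd] := tight_exploration uR (H uR).
have aP : all (mem (walk d p w ++ walk d q w)) (walk d p w).
  by apply/allP => g gw; rewrite inE mem_cat gw.
have aQ : all (mem (walk d p w ++ walk d q w)) (walk d q w).
  by apply/allP => g gw; rewrite inE mem_cat gw orbT.
have pR : mem [:: p; q] p by rewrite /= mem_head.
have qR : mem [:: p; q] q by rewrite /= !inE eqxx orbT.
by have [] := walk_inj inj (fun _ => id) Rd pR qR aP aQ mE.
Qed.

Lemma cycle_coll p w e0 : (0 < size w)%N -> run d w p = p ->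
  has (coll (size w) (fun d => walk d p w) [:: p] e0 d) (iota 0 (size w)).
Proof.
move=> w0 mE; rewrite has_count lt0n; apply/eqP => c0.
have := card_coll (Rt := [:: p]) e0 (explores_walk p w) d.
rewrite c0 addn0 => H.
have [_ Rd] := tight_exploration (isT : uniq [:: p]) (H isT).
case/lastP: w w0 mE Rd {c0 H} => // w c _; rewrite run_rcons walk_rcons => pE.
by move=> /(_ (run d w p, c)); rewrite mem_rcons inE eqxx pE inE eqxx => /(_ isT).
Qed.

(** At the last step before they meet, the walks leave distinct states, hence by distinct arrows.
    Once merged they stay merged, so this step cannot precede position [i0]. *)
Lemma first_merge p q u w i0 (e0 : arrow) : (i0 <= size w)%N -> u = take i0 w ->
  run d u p != run d u q -> run d w p = run d w q ->
  exists i, [/\ (i0 <= i)%N, (i < size w)%N &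
   let e1 := nth e0 (walk d p w) i in let e2 := nth e0 (walk d q w) i in
   e1 != e2 /\ d e1 = d e2].
Proof.
move=> i0w -> un mE.
pose m i := run d (take i w) p == run d (take i w) q.
have ex : exists i, m i by exists (size w); rewrite /m take_size mE.
case: (ex_minnP ex) => i mi imin.
have mono j k : (j <= k)%N -> m j -> m k.
  move=> jk; rewrite /m => /eqP mj; have -> : take k w = take j w ++ drop j (take k w).
    by rewrite -{1}(cat_take_drop j (take k w)) take_takel.
  by rewrite !run_cat mj.
have i0i : (i0 < i)%N by rewrite ltnNge; apply: contra un => /mono /(_ mi).
have iw : (i <= size w)%N by apply: imin; rewrite /m take_size mE.
case: i i0i iw mi imin => // i i0i iw mi imin; exists i; split=> //=.
rewrite !nth_walk//; split.
  apply/eqP => -[/eqP /imin]; by rewrite ltnn.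
by move: mi; rewrite /m (take_nth e0.2)// !run_rcons => /eqP.
Qed.

(** A single collision leaves a forest with one extra arrow, hence one place where paths can join.
    Both words would merge there, and uniqueness of the paths up to it forces either a common prefix
    of length [j0], against [u != u'], or [p = q]. Being apart after [u] and [u'] keeps both merges
    beyond these prefixes. *)
Lemma double_merge_coll p q j0 (u u' v : word) e0 (m := ((j0 + size v) + (j0 + size v) + ((j0 + size v) + (j0 + size v)))%N) : p != q -> u != u' ->
  size u = j0 -> size u' = j0 ->
  run d u p != run d u q -> run d u' p != run d u' q ->
  run d (u ++ v) p = run d (u ++ v) q -> run d (u' ++ v) p = run d (u' ++ v) q ->
  coll_twice m (fun d => (walk d p (u ++ v) ++ walk d q (u ++ v)) ++
    (walk d p (u' ++ v) ++ walk d q (u' ++ v))) [:: p; q] e0 d.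
Proof.
move=> pq uu' su su' un un' mE mE'; set F := fun d => _ ++ _.
set w1 := u ++ v; set w2 := u' ++ v.
have s1 : size w1 = (j0 + size v)%N by rewrite size_cat su.
have s2 : size w2 = (j0 + size v)%N by rewrite size_cat su'.
have HF : explores m F.
  by rewrite /m -{1 2}s1 -s2; do 2![apply: explores_cat]; exact: explores_walk.
apply: contraT => ntwice.
have c1 : (count (coll m F [:: p; q] e0 d) (iota 0 m) <= 1)%N.
  rewrite leqNgt; apply: contra ntwice => /count_lt[t [t' [tt' t'm ct ct']]].
  apply/hasP; exists t'; rewrite ?mem_iota//; apply/hasP; exists t.
    by rewrite mem_iota /= add0n (ltn_trans tt').
  by rewrite tt' ct ct'.
have := card_coll (Rt := [:: p; q]) e0 HF d; rewrite /= inE pq => /(_ isT).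
set C := F d; set B := #|[pred v | v \in _]| => le.
have {c1}le : (2 + #|C| <= B + 1)%N by apply: leq_trans le _; rewrite leq_add2l.
have tight e e' : e \in C -> e' \in C -> e != e' -> d e = d e' ->
   {in [pred g in C | g != e'] &, injective d} /\
   {in [pred g in C | g != e'], forall g, d g \notin [:: p; q]}.
  move=> eC e'C ee' dee'.
  have cE : #|[seq g <- C | g != e']|.+1 = #|C|.
    rewrite [RHS](cardD1 e') e'C add1n; congr _.+1.
    by apply: eq_card => g; rewrite mem_filter !inE.
  have := @tight_exploration [:: p; q] [seq g <- C | g != e']; rewrite /= inE pq.
  have -> : #|[pred v in [:: p, q & [seq d g | g <- C & g != e']]]| = B.
    apply: eq_card => x; rewrite !inE; do 2![congr orb].
    apply/mapP/mapP => -[g].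
      by rewrite mem_filter => /andP[_ gC] ->; exists g.
    move=> gC ->.
    have [->|ge'] := eqVneq g e'; last by exists g; rewrite // mem_filter ge'.
    by exists e; rewrite ?mem_filter ?ee'.
  move=> /(_ isT) []; first by rewrite -ltnS -addnS cE -(addn1 B).
  move=> inj Rd; split=> [g g' gC g'C|g gC].
    by apply: inj; rewrite mem_filter andbC.
  by apply: Rd; rewrite mem_filter andbC.
have mem1p g : g \in walk d p w1 -> g \in C by rewrite /C /F !mem_cat => ->.
have mem1q g : g \in walk d q w1 -> g \in C by rewrite /C /F !mem_cat => ->; rewrite !orbT.
have mem2p g : g \in walk d p w2 -> g \in C by rewrite /C /F !mem_cat => ->; rewrite !orbT.
have mem2q g : g \in walk d q w2 -> g \in C by rewrite /C /F !mem_cat => ->; rewrite !orbT.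
have ju : (j0 <= size w1)%N by rewrite s1 leq_addr.
have ju' : (j0 <= size w2)%N by rewrite s2 leq_addr.
have tu : take j0 w1 = u by rewrite /w1 -su take_size_cat.
have tu' : take j0 w2 = u' by rewrite /w2 -su' take_size_cat.
have [i [j0i iw [e12 de12]]] := first_merge e0 ju (esym tu) un mE.
have [i' [j0i' iw' [e12' de12']]] := first_merge e0 ju' (esym tu') un' mE'.
set e1 := nth e0 (walk d p w1) i in e12 de12.
set e2 := nth e0 (walk d q w1) i in e12 de12.
set e1' := nth e0 (walk d p w2) i' in e12' de12'.
set e2' := nth e0 (walk d q w2) i' in e12' de12'.
have e1C : e1 \in C by apply: mem1p; rewrite mem_nth// size_walk.
have e2C : e2 \in C by apply: mem1q; rewrite mem_nth// size_walk.
have e1'C : e1' \in C by apply: mem2p; rewrite mem_nth// size_walk.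
have e2'C : e2' \in C by apply: mem2q; rewrite mem_nth// size_walk.
have [injA RdA] := tight _ _ e1C e2C e12 de12.
have [injB RdB] := tight _ _ e2C e1C (negbT (introF eqP (fun h => elimN eqP e12 (esym h)))) (esym de12).
(* An arrow of [C0] shares its target with no other arrow of [C]: delete whichever of [e1], [e2] is
   not the competitor. *)
pose C0 := [pred g in C | (g != e1) && (g != e2)].
have inj0 g g' : C0 g -> g' \in C -> d g = d g' -> g = g'.
  move=> /and3P[gC g1 g2] g'C dg; have [g'2|g'2] := eqVneq g' e2.
    by apply: injB => //; rewrite !inE ?gC// g'C g'2 eq_sym.
  by apply: injA => //; rewrite !inE ?gC// g'C g'2.
have Rd0 g : g \in C -> d g \notin [:: p; q].
  move=> gC; have [->|g2] := eqVneq g e2; last by apply: RdA; rewrite !inE gC.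
  by rewrite -de12; apply: RdA; rewrite !inE e1C.
have WI r r' x x' : r \in [:: p; q] -> r' \in [:: p; q] ->
   all C0 (walk d r x) -> {subset walk d r' x' <= C} -> run d x r = run d x' r' ->
   r = r' /\ x = x'.
  move=> Rr Rr' a0 /allP a'.
  apply: (@walk_inj n d C0 (mem C) (mem [:: p; q])) => //.
  by move=> g /and3P[].
have pR : p \in [:: p; q] by rewrite mem_head.
have qR : q \in [:: p; q] by rewrite !inE eqxx orbT.
have sub1p k : {subset walk d p (take k w1) <= C}.
  by move=> g; rewrite -take_walk => /mem_take/mem1p.
have sub1q k : {subset walk d q (take k w1) <= C}.
  by move=> g; rewrite -take_walk => /mem_take/mem1q.
have sub2p k : {subset walk d p (take k w2) <= C}.
  by move=> g; rewrite -take_walk => /mem_take/mem2p.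
have e1E : e1.1 = run d (take i w1) p by rewrite /e1 nth_walk.
have e2E : e2.1 = run d (take i w1) q by rewrite /e2 nth_walk.
have e1E' : e1'.1 = run d (take i' w2) p by rewrite /e1' nth_walk.
pose P2 := pred2 e1 e2.
(* Cut the walk at its first passage through [e1] or [e2]: the part before it lies in [C0], where
   paths are unique. *)
have early r : r \in [:: p; q] -> {subset walk d r w1 <= C} ->
    P2 (nth e0 (walk d r w1) i) -> exists2 a, (a <= i)%N &
    all C0 (walk d r (take a w1)) /\ (run d (take a w1) r = e1.1 \/ run d (take a w1) r = e2.1).
  move=> rR sC Pi; pose a := find P2 (walk d r w1).
  have hs : has P2 (walk d r w1).
    by apply/hasP; exists (nth e0 (walk d r w1) i); rewrite ?mem_nth ?size_walk.
  have aw : (a < size w1)%N by rewrite -(size_walk d r w1) -has_find.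
  have ai : (a <= i)%N by rewrite leqNgt; apply/negP => /(before_find e0); rewrite Pi.
  exists a => //; split.
    rewrite -take_walk; apply/(all_nthP e0) => k; rewrite size_take size_walk aw => ka.
    rewrite nth_take// /C0 /=; have /negbT := before_find e0 ka.
    rewrite /P2 /= negb_or => ->; rewrite andbT; apply: sC.
    by rewrite mem_nth// size_walk (ltn_trans ka).
  have := nth_find e0 hs; rewrite -/a nth_walk// /P2 /= => /orP[]/eqP <-; [left|right]; done.
have [a ai [aC aE]] := early p pR mem1p (predU1l _ (erefl _)).
have [b bi [bC bE]] : exists2 b, (b <= i)%N &
    all C0 (walk d q (take b w1)) /\ (run d (take b w1) q = e1.1 \/ run d (take b w1) q = e2.1).
  by apply: early => //; rewrite /P2 /= -/e2 eqxx orbT.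
(* By uniqueness this first passage occurs at step [i] itself, so the whole path from [p] to the
   source of [e1] lies in [C0]. *)
have pC0 : all C0 (walk d p (take i w1)).
  case: aE => aE; last first.
    by have [pq'] := WI _ _ _ _ pR qR aC (sub1q i) (etrans aE e2E); rewrite pq' eqxx in pq.
  by have [_ <-] := WI _ _ _ _ pR pR aC (sub1p i) (etrans aE e1E).
have qC0 : all C0 (walk d q (take i w1)).
  case: bE => bE.
    by have [pq'] := WI _ _ _ _ qR pR bC (sub1p i) (etrans bE e1E); rewrite pq' eqxx in pq.
  by have [_ <-] := WI _ _ _ _ qR qR bC (sub1q i) (etrans bE e2E).
(* The second merge must use the same redundancy, since off [e1] and [e2] the target determines the
   arrow. *)
have : (e1' == e1) || (e1' == e2).
  apply/negPn/negP; rewrite negb_or => e1'n.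
  have c : C0 e1' by rewrite /C0 /= e1'C.
  by move: e12'; rewrite (inj0 _ _ c e2'C de12') eqxx.
case/orP => /eqP e1'E.
  have [_ tE] := WI _ _ _ _ pR pR pC0 (sub2p i') (etrans (esym e1E) (etrans (congr1 fst (esym e1'E)) e1E')).
  move: (congr1 (take j0) tE); rewrite !take_takel// tu tu' => /eqP.
  by rewrite (negPf uu').
have [pq' _] := WI _ _ _ _ qR pR qC0 (sub2p i') (etrans (esym e2E) (etrans (congr1 fst (esym e1'E)) e1E')).
by rewrite pq' eqxx in pq.
Qed.

End Coincidences.

(** * The image of a power of a letter *)

Section BackwardTree.
Variables (R : realType) (V : finType).
Implicit Types (W L B : {set V}) (f g : {ffun V -> V}).

Lemma sum_subsets (a b : R) W :
  \sum_(J : {set V} | J \subset W) a ^+ #|J| * b ^+ #|W :\: J| = (a + b) ^+ #|W|.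
Proof.
pose F i := if i \in W then a else 0.
pose G i := if i \in W then b else 1.
transitivity (\prod_i (F i + G i)); last first.
  rewrite -prodr_const [RHS]big_mkcond /=; apply: eq_bigr => i _.
  by rewrite /F /G; case: ifP => // _; rewrite add0r.
rewrite bigA_distr /= big_mkcond; apply: eq_bigr => J _.
case: (boolP (J \subset W)) => [JW|/subsetPn[i iJ iW]]; last first.
  by rewrite (bigD1 i)//= iJ /F (negPf iW) mul0r.
rewrite /= -!prodr_const [X in X * _]big_mkcond [X in _ * X]big_mkcond -big_split /=; apply: eq_bigr => i _.
rewrite /F /G finset.in_setD; case: (boolP (i \in J)) => [/(fintype.subsetP JW) ->|_] /=.
  by rewrite mulr1.
by rewrite mul1r.
Qed.

(* [no_chain k W L f]: no [f]-path of length [k] runs inside [W] and then ends in [L]. *)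
Fixpoint no_chain k W L f :=
  if k is k'.+1 then
    let L1 := [set p in W | f p \in L] in no_chain k' (W :\: L1) L1 f
  else L == finset.set0.

(** Probability that a Galton-Watson tree with Poisson offspring of mean 1 has died out by
    generation [k]; such a tree is the limit of the backward tree of a state under a random map. *)
Fixpoint extinction k : R := if k is k'.+1 then expR (extinction k' - 1) else 0.

Lemma extinction_bounds k : 0 <= extinction k <= 1.
Proof.
elim: k => [|k /andP[x0 x1]] /=; first by rewrite lexx ler01.
by rewrite expR_ge0 -[leRHS]expR0 ler_expR subr_le0.
Qed.

(** With [y = 1 - x], the bound [exp (- y) >= (1 - y / 2) ^ 2] makes one step at most
    [y - y ^ 2 / 4], a recursion dominated by the sequence [4 / (k + 4)]. *)
Lemma extinction_ge k : 1 - 4 / (k%:R + 4) <= extinction k.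
Proof.
elim: k => [|k ih] /=; first by rewrite add0r divff// subrr.
have /andP[x0 x1] := extinction_bounds k.
set x := extinction k in ih x0 x1 *; set y := 1 - x.
have -> : x - 1 = - (y / 2) + - (y / 2) by rewrite /y; lra.
rewrite expRD; set s := expR _.
have hs : 1 - y / 2 <= s by have := expR_ge1Dx (- (y / 2)).
have k0 : 0 <= k%:R :> R by [].
set z := 4 / (k%:R + 4) in ih.
have zk : z * (k%:R + 4) = 4 by rewrite /z divfK// gt_eqF// ltr_wpDl.
have z0 : 0 <= z by rewrite divr_ge0// addr_ge0.
have z1 : z <= 1 by rewrite ler_pdivrMr ?mul1r ?ltr_wpDl// lerDr.
set z' := 4 / _.
have zk' : z' * (k%:R + 5) = 4.
  have -> : k%:R + 5 = k.+1%:R + 4 :> R by rewrite -[k.+1%:R]natr1; ring.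
  by rewrite /z' divfK// gt_eqF// ltr_wpDl.
have hy : y <= z by rewrite /y; lra.
have y0 : 0 <= y by rewrite /y; lra.
have ss : 1 - y + y ^+ 2 / 4 <= s * s.
  have -> : 1 - y + y ^+ 2 / 4 = (1 - y / 2) * (1 - y / 2) by field.
  by apply: ler_pM => //; lra.
have zz : 1 - z + z ^+ 2 / 4 <= 1 - y + y ^+ 2 / 4 by nra.
suff : 1 - z' <= 1 - z + z ^+ 2 / 4 by lra.
have z2 : z ^+ 2 / 4 * (k%:R + 4) = z by rewrite expr2; nra.
nra.
Qed.

(** One generation of the comparison with the Poisson tree: with [y = 1 - x],
    [(1 - y l / N) ^ m >= exp (- y l)] as soon as [m <= N - y l], which [m + l <= N] ensures. *)
Lemma extinction_pow (x : R) (l m N : nat) : (m + l <= N)%N -> 0 <= x <= 1 ->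
  expR (x - 1) ^+ l * N%:R ^+ m <= (l%:R * x + (N - l)%:R) ^+ m.
Proof.
move=> mlN /andP[x0 x1]; have [->|m0] := posnP m.
  by rewrite !expr0 mulr1 exprn_ile1 ?expR_ge0// -[leRHS]expR0 ler_expR subr_le0.
set y := 1 - x; have -> : x - 1 = - y by rewrite /y; lra.
have -> : l%:R * x + (N - l)%:R = N%:R - y * l%:R :> R.
  by rewrite natrB ?/y; [lra|lia].
set D := N%:R - _.
have mD : m%:R <= D.
  have : (m%:R + l%:R <= N%:R :> R) by rewrite -natrD ler_nat.
  have : 0 <= l%:R :> R by [].
  by rewrite /D /y; nra.
have D0 : 0 < D by apply: lt_le_trans mD; rewrite ltr0n.
rewrite -expRM_natl mulrN expRN mulrC ler_pdivrMr ?expR_gt0// -ler_pdivrMl ?exprn_gt0//.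
rewrite mulrC -expr_div_n.
have ND : N%:R / D = 1 + y * l%:R / D.
  by rewrite -[X in X + _](divff (lt0r_neq0 D0)) -mulrDl /D subrK.
apply: (@le_trans _ _ (expR (y * l%:R / D) ^+ m)).
  by rewrite lerXn2r ?nnegrE ?expR_ge0 ?divr_ge0 ?(ltW D0)// ND expR_ge1Dx.
rewrite -expRM_natl ler_expR mulrA ler_pdivrMr// [leRHS]mulrC [l%:R * y]mulrC.
by rewrite ler_wpM2r// mulr_ge0// /y subr_ge0.
Qed.

(** Maps still open on [W], where only membership in [B] is known, and already revealed as [g]
    elsewhere. *)
Definition frozen W B g := [pred f : {ffun V -> V} |
  [forall p, if p \in W then f p \in B else f p == g p]].

Lemma card_frozen W B g : #|frozen W B g| = (#|B| ^ #|W|)%N.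
Proof.
pose F p := if p \in W then mem B else mem (pred1 (g p)).
have -> : #|frozen W B g| = #|family F|.
  apply: eq_card => f; rewrite !inE; apply/forallP/familyP => h p; have := h p;
  by rewrite /F; case: ifP; rewrite ?inE.
rewrite card_family foldrE big_map big_enum /= -prod_nat_const [RHS]big_mkcond /=.
apply: eq_bigr => p _; rewrite /F; case: ifP => // _.
by rewrite -[RHS](card1 (g p)); apply: eq_card.
Qed.

(** Reveal the set [J] of states of [W] sent into [L]: it is the next generation, and the rest of
    [W] now takes values in [B :\: L]. Summing the induction hypothesis over [J] gives, by the
    binomial theorem, [(#|L| x + #|B| - #|L|) ^ #|W|] for the previous extinction value [x], and
    [extinction_pow] concludes. *)
Lemma no_chain_count k W L B g : W :|: L \subset B -> [disjoint W & L] ->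
  extinction k ^+ #|L| * #|B|%:R ^+ #|W| <=
  #|[pred f | frozen W B g f && no_chain k W L f]|%:R.
Proof.
elim: k W L B g => [|k ih] W L B g WLB dWL.
  rewrite /=; case: eqP => [->|/eqP L0].
    rewrite cards0 expr0 mul1r -natrX ler_nat -(card_frozen W B g).
    by apply: subset_leq_card; apply/fintype.subsetP => f; rewrite !inE andbT.
  by rewrite expr0n cards_eq0 (negPf L0) mul0r.
have WB : W \subset B by apply: fintype.subset_trans WLB; apply: finset.subsetUl.
have LB : L \subset B by apply: fintype.subset_trans WLB; apply: finset.subsetUr.
have cBL : #|B :\: L| = (#|B| - #|L|)%N by rewrite finset.cardsD (finset.setIidPr LB).
have x01 := extinction_bounds k.
have le1 : extinction k.+1 ^+ #|L| * #|B|%:R ^+ #|W| <=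
    (#|L|%:R * extinction k + (#|B| - #|L|)%:R) ^+ #|W|.
  apply: extinction_pow x01.
  by rewrite -cardsUI (disjoint_setI0 dWL) cards0 addn0 subset_leq_card.
apply: le_trans le1 _; rewrite -sum_subsets.
pose key f := ([set p in W | f p \in L], [ffun p => if (p \in W) && (f p \in L) then f p else g p]).
pose Q f := frozen W B g f && no_chain k.+1 W L f.
have -> : #|[pred f | Q f]| = (\sum_(J : {set V}) \sum_(h : {ffun V -> V})
   #|[pred f | Q f && (key f == (J, h))]|)%N.
  rewrite -sum1_card (partition_big key predT)//= pair_bigA /=.
  by apply: eq_bigr => -[J h] _; rewrite sum1_card; apply: eq_card.
rewrite natr_sum big_mkcond /=; apply: ler_sum => J _.
case: (boolP (J \subset W)) => // JW.
apply: (@le_trans _ _ (\sum_(h in frozen J L g)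
   extinction k ^+ #|J| * #|B :\: L|%:R ^+ #|W :\: J|)).
  by rewrite sumr_const card_frozen -[leRHS]mulr_natl natrX mulrA exprMn cBL.
rewrite natr_sum big_mkcond /=; apply: ler_sum => h _.
case: ifP => // hJ.
apply: le_trans (ih (W :\: J) J (B :\: L) h _ _) _.
- apply/fintype.subsetP => p pU; have pW : p \in W.
    by move: pU; rewrite !inE => /orP[/andP[]//|/(fintype.subsetP JW)].
  by rewrite finset.in_setD (disjointFr dWL pW) (fintype.subsetP WB).
- by rewrite -finset.setI_eq0; apply/eqP/finset.setP => p; rewrite !inE; case: (p \in J); rewrite ?andbF.
rewrite ler_nat subset_leq_card//; apply/fintype.subsetP => f; rewrite !inE.
move=> /andP[/forallP ff nc].
have fJ p : p \in J -> f p \in L /\ h p = f p.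
  move=> pJ; have := ff p; rewrite finset.in_setD pJ /= => /eqP ->.
  by move: hJ; rewrite !inE => /forallP/(_ p); rewrite pJ.
have fW p : p \in W -> p \notin J -> f p \in B :\: L.
  by move=> pW pJ; have := ff p; rewrite finset.in_setD pJ pW.
have fN p : p \notin W -> f p = g p.
  move=> pW; have := ff p; rewrite finset.in_setD (negPf pW) andbF => /eqP ->.
  have pJ : p \notin J by apply: contra pW => /(fintype.subsetP JW).
  by move: hJ; rewrite !inE => /forallP/(_ p); rewrite (negPf pJ) => /eqP.
have hN p : p \notin J -> h p = g p.
  by move=> pJ; move: hJ; rewrite !inE => /forallP/(_ p); rewrite (negPf pJ) => /eqP.
have JE : [set p in W | f p \in L] = J.
  apply/finset.setP => p; rewrite !inE; apply/andP/idP => [[pW]|pJ].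
    by apply: contraTT => /(fW p pW); rewrite finset.in_setD => /andP[].
  by split; [exact: (fintype.subsetP JW)|have [] := fJ p pJ].
rewrite /Q /= JE nc andbT /key JE xpair_eqE eqxx /=; apply/andP; split.
  apply/forallP => p; case: ifP => [pW|/negbT/fN ->]//.
  case: (boolP (p \in J)) => [/fJ[fL _]|/(fW p pW)]; first exact: (fintype.subsetP LB).
  by rewrite finset.in_setD => /andP[].
apply/eqP/ffunP => p; rewrite ffunE.
have := congr1 (fun A : {set V} => p \in A) JE; rewrite inE => ->.
by case: (boolP (p \in J)) => [/fJ[_ ->]|/hN].
Qed.

Lemma no_chainPn k W L f p : [disjoint W & L] ->
  (forall i, (i < k)%N -> iter i f p \in W) -> iter k f p \in L ->
  ~~ no_chain k W L f.
Proof.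
elim: k W L => [|k ih] W L dWL iW iL /=.
  by apply/finset.set0Pn; exists p.
apply: ih.
- by rewrite -finset.setI_eq0; apply/eqP/finset.setP => q; rewrite !inE; case: (q \in W); case: (f q \in L).
- move=> i ik; rewrite !inE iW ?(leqW ik)//= andbT -iterS.
  have : iter i.+1 f p \in W by apply: iW.
  by apply: contraL => iL'; rewrite (disjointFl dWL).
- by rewrite inE iW//= -iterS.
Qed.

(** A first passage at [z] after exactly [k] steps is a chain in the complement of [z], so
    [1 - extinction k] bounds its probability. The value at [z] itself is free and contributes a
    factor [N] to the count. *)
Lemma Pr_deep_ancestor k (z : V) :
  Pr R (fun f : {ffun V -> V} => [exists p, (iter k f p == z) &&
     [forall i : 'I_k, iter i f p != z]]) <= 4 / (k%:R + 4).
Proof.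
have V0 : (0 < #|V|)%N by apply/card_gt0P; exists z.
set N := #|V|; pose W := ~: [set z].
have cW : #|W|.+1 = N by rewrite -add1n -(cards1 z) cardsC.
have dW : [disjoint W & [set z]] by rewrite -finset.setI_eq0; apply/eqP/finset.setP => p; rewrite !inE; case: (p == z).
pose nc f := no_chain k W [set z] f.
have le : Pr R (fun f => ~~ nc f) <= 4 / (k%:R + 4).
  have -> : Pr R (fun f => ~~ nc f) = 1 - Pr R nc.
    have T0 : (0 < #|{ffun V -> V}|)%N by rewrite card_ffun expn_gt0 V0.
    rewrite -(@Ex_cst R {ffun V -> V} 1)// /Pr; apply/eqP; rewrite eq_sym subr_eq.
    by rewrite -ExD; apply/eqP; apply: eq_Ex => f; case: (nc f); rewrite ?add0r ?addr0.
  have : extinction k <= Pr R nc.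
    rewrite PrE ler_pdivlMr ?ltr0n ?card_ffun ?expn_gt0 ?V0//.
    rewrite -/N -{2}cW expnS natrM.
    have -> : #|nc| = (\sum_(v : V) #|[pred f | nc f && (f z == v)]|)%N.
      rewrite -sum1_card (partition_big (fun f : {ffun V -> V} => f z) predT)//=.
      by apply: eq_bigr => v _; rewrite sum1_card; apply: eq_card.
    rewrite natr_sum mulrA mulrAC mulr_natr -/N -sumr_const; apply: ler_sum => v _.
    apply: (@le_trans _ _ (extinction k ^+ #|[set z]| * #|[set: V]|%:R ^+ #|W|)).
      by rewrite cards1 expr1 natrX cardsT.
    apply: le_trans (no_chain_count k [ffun=> v] (finset.subsetT _) dW) _.
    rewrite ler_nat subset_leq_card//; apply/fintype.subsetP => f; rewrite !inE.
    move=> /andP[/forallP/(_ z)]; rewrite !inE eqxx /= ffunE => ->.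
    by rewrite andbT.
  by have := extinction_ge k; lra.
apply: le_trans le; apply: le_Pr => f /existsP[p /andP[pz /forallP iz]].
apply: (@no_chainPn k W [set z] f p dW) => [i ik|]; last by rewrite inE.
by rewrite !inE (iz (Ordinal ik)).
Qed.

End BackwardTree.

(** * Expected image size and merging probabilities *)

Section Moments.
Variables (R : realType) (n : nat).
Hypothesis n0 : (0 < n)%N.
Notation V := 'I_n.
Implicit Types (d : automaton n) (w : word).

Definition letter_map d (c : letter) : {ffun V -> V} := [ffun x => d (x, c)].

(** An automaton is a pair of independent uniform maps, one for each letter. *)
Lemma Ex_letter_map c (g : {ffun V -> V} -> R) :
  Ex (fun d : automaton n => g (letter_map d c)) = Ex g.
Proof.
pose h (z : {ffun V -> V} * {ffun V -> V}) : automaton n :=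
  [ffun e => if e.2 == c then z.1 e.1 else z.2 e.1].
pose h' (d : automaton n) := (letter_map d c, letter_map d (~~ c)).
have hK : cancel h h'.
  move=> [f f']; congr pair; apply/ffunP => x; rewrite !ffunE /= ?eqxx//.
  by case: eqP => // e; move: e; case: (c).
have h'K : cancel h' h.
  move=> d; apply/ffunP => -[x b]; rewrite ffunE /= /letter_map !ffunE.
  by case: eqP => [->|]//; case: b; case: (c).
have hb : {on predT, bijective h} by exists h' => ? _; [exact: hK|exact: h'K].
have V0 : (0 < #|{ffun V -> V}|)%N by rewrite card_ffun card_ord expn_gt0 n0.
transitivity (Ex (fun z : {ffun V -> V} * {ffun V -> V} => g z.1)).
  rewrite /Ex (reindex h)//=; congr (_ / _%:R).
    by apply: eq_bigr => z _; rewrite -[letter_map _ c]/((h' (h z)).1) hK.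
  by apply/esym/bij_eq_card; exists h'.
rewrite /Ex card_prod natrM -(pair_bigA _ (fun f _ => g f)) /=.
under eq_bigr do rewrite sumr_const.
rewrite sumrMnl -[X in X / _]mulr_natr invfM mulrACA divff ?mulr1//.
by rewrite pnatr_eq0 -lt0n.
Qed.

Lemma run_nseq d k c p : run d (nseq k c) p = iter k (letter_map d c) p.
Proof.
elim: k p => //= k ih p; rewrite -iterS iterSr -ih /run /=; congr foldl.
by rewrite ffunE.
Qed.

Lemma Pr_return j c (z : V) : (0 < j)%N ->
  Pr R (fun d => run d (nseq j c) z == z) <= (j * j.+1)%:R / n%:R.
Proof.
move=> j0; have := coll1 R [:: z] (z, c) (explores_walk z (nseq j c)) n0.
rewrite size_nseq addn1; apply: le_trans; apply: le_Pr => d /eqP zE.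
have := @cycle_coll n d z (nseq j c) (z, c).
by rewrite size_nseq; apply.
Qed.

(** Take a path of length [k] ending at [z]. Either it meets [z] only at its end, so that [z] has a
    deep ancestor, or it met [z] before, so that [z] lies on a cycle of length at most [k], which is
    rare. *)
Lemma Ex_image k c :
  Ex (fun d => #|[set run d (nseq k c) p | p : V]|%:R) <=
  n%:R * (4 / (k%:R + 4)) + (k * (k * k.+1))%:R :> R.
Proof.
pose deep (z : V) d := [exists p, (iter k (letter_map d c) p == z) &&
     [forall i : 'I_k, iter i (letter_map d c) p != z]].
pose back (z : V) d := has (fun j => run d (nseq j c) z == z) (iota 1 k).
apply: (@le_trans _ _ (\sum_(z : V) (Pr R (deep z) + Pr R (back z)))).
  under eq_bigr do rewrite /Pr -ExD.
  rewrite -Ex_sum; apply: le_Ex => d; rewrite -sum1_card natr_sum big_mkcond /=.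
  apply: ler_sum => z _; case: ifP => // /imsetP[p _ zE].
  rewrite -natrD ler1n lt0n addn_eq0 !eqb0 negb_and !negbK.
  have [h|] := boolP [forall i : 'I_k, iter i (letter_map d c) p != z].
    apply/orP; left; apply/existsP; exists p; rewrite h andbT.
    by rewrite -run_nseq -zE.
  rewrite negb_forall => /existsP[i]; rewrite negbK => /eqP iz.
  apply/orP; right; apply/hasP; exists (k - i)%N.
    by rewrite mem_iota; have := ltn_ord i; lia.
  by rewrite run_nseq -{1}iz -iterD subnK -?run_nseq -?zE// ltnW.
rewrite big_split /=; apply: lerD.
  apply: (@le_trans _ _ (\sum_(z : V) 4 / (k%:R + 4))).
    by apply: ler_sum => z _; rewrite /Pr (Ex_letter_map c (fun f : {ffun V -> V} =>
      [exists p, (iter k f p == z) && [forall i : 'I_k, iter i f p != z]]%:R)) Pr_deep_ancestor.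
  by rewrite sumr_const card_ord [leRHS]mulr_natl.
apply: (@le_trans _ _ (\sum_(z : V) (k * (k * k.+1))%:R / n%:R)); last first.
  by rewrite sumr_const card_ord -[leLHS]mulr_natr divfK// pnatr_eq0 -lt0n.
apply: ler_sum => z _.
apply: le_trans (Pr_has _ _ (fun j d => run d (nseq j c) z == z)) _.
apply: (@le_trans _ _ (\sum_(j <- iota 1 k) (k * k.+1)%:R / n%:R)).
  rewrite big_seq [leRHS]big_seq; apply: ler_sum => j; rewrite mem_iota => /andP[j0 jk].
  apply: le_trans (Pr_return _ _ j0) _.
  by rewrite ler_wpM2r ?invr_ge0// ler_nat leq_mul//; lia.
rewrite big_const_seq count_predT size_iota iter_addr_0.
by rewrite -[leLHS]mulr_natl mulrA -natrM.
Qed.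

Lemma Pr_merge w p q : p != q ->
  Pr R (fun d => run d w p == run d w q) <=
  ((size w + size w) * (size w + size w + 2))%:R / n%:R.
Proof.
move=> pq; have := coll1 R [:: p; q] (p, false)
  (explores_cat (explores_walk p w) (explores_walk q w)) n0.
by apply: le_trans; apply: le_Pr => d /eqP mE; exact: merge_coll.
Qed.

Lemma Pr_double_merge p q (u u' v : word) j0
    (m := ((j0 + size v) + (j0 + size v) + ((j0 + size v) + (j0 + size v)))%N) : p != q -> u != u' ->
  size u = j0 -> size u' = j0 ->
  Pr R (fun d => [&& run d u p != run d u q, run d u' p != run d u' q,
     run d (u ++ v) p == run d (u ++ v) q & run d (u' ++ v) p == run d (u' ++ v) q]) <=
  ((m * (m + 2))%:R / n%:R) ^+ 2.
Proof.
move=> pq uu' su su'.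
pose F (d : automaton n) := (walk d p (u ++ v) ++ walk d q (u ++ v)) ++
    (walk d p (u' ++ v) ++ walk d q (u' ++ v)).
have HF : explores m F.
  have := explores_cat
    (explores_cat (explores_walk p (u ++ v)) (explores_walk q (u ++ v)))
    (explores_cat (explores_walk p (u' ++ v)) (explores_walk q (u' ++ v))).
  by rewrite !size_cat su su'.
have := coll2 R [:: p; q] (p, false) HF n0.
apply: le_trans; apply: le_Pr => d /and4P[un un' /eqP mE /eqP mE'].
exact: double_merge_coll.
Qed.

End Moments.

(** * Separating two states by a short word *)

Section CleanPairs.
Variables (n : nat) (d : automaton n).
Notation V := 'I_n.
Notation arrow := (V * letter)%type.

Definition nb (A : {set V}) : {set V} := A :|: [set d e | e in finset.setX A [set: letter]].

Definition clean J (u v : V) := u != v /\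
  (forall r r' w w', r \in [:: u; v] -> r' \in [:: u; v] ->
   (size w <= J)%N -> (size w' <= J)%N -> run d w r = run d w' r' -> r = r' /\ w = w').

Lemma clean_sym J u v : clean J u v -> clean J v u.
Proof.
move=> [uv h]; split; first by rewrite eq_sym.
have sw a : a \in [:: v; u] -> a \in [:: u; v] by rewrite !inE orbC.
by move=> r r' w w' /sw Rr /sw Rr'; apply: h.
Qed.

Lemma mem_nb (A : {set V}) e : e.1 \in A -> d e \in nb A.
Proof.
move=> eA; rewrite inE; apply/orP; right; apply/imsetP; exists e => //.
by rewrite !inE eA.
Qed.

Lemma subset_nb (A : {set V}) : A \subset nb A.
Proof. exact: finset.subsetUl. Qed.

Lemma sub_iter_nb i j (A : {set V}) : (i <= j)%N -> iter i nb A \subset iter j nb A.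
Proof.
move=> /subnK <-; elim: (j - i)%N => // k ih.
by rewrite addSn; apply: fintype.subset_trans ih _; exact: subset_nb.
Qed.

Lemma run_iter_nb w k (A : {set V}) r : r \in A -> (size w <= k)%N ->
  run d w r \in iter k nb A.
Proof.
move=> rA; elim/last_ind: w k => [|w c ih] k.
  by move=> _; apply: (fintype.subsetP (sub_iter_nb A (leq0n k))).
rewrite size_rcons run_rcons; case: k => // k wk.
by rewrite iterS; apply: mem_nb; apply: ih.
Qed.

Lemma card_iter_nb k (A : {set V}) : (#|iter k nb A| <= #|A| * 3 ^ k)%N.
Proof.
elim: k => [|k ih]; first by rewrite muln1.
rewrite iterS expnSr mulnA; set B := iter k nb A in ih *.
apply: leq_trans (_ : #|B| * 3 <= _)%N; last by rewrite leq_mul2r ih orbT.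
apply: leq_trans (leq_card_setU _ _) _.
apply: leq_trans (leq_add (leqnn _) (leq_imset_card _ _)) _.
by rewrite cardsX cardsT card_bool -mulnS.
Qed.

Lemma iter_nb_target k (A : {set V}) v : v \in iter k nb A -> v \notin A ->
  exists2 e, e.1 \in iter k nb A & d e = v.
Proof.
elim: k => [|k ih] /=; first by move=> ->.
set B := iter k nb A in ih *; move=> + vA; have BB := fintype.subsetP (subset_nb B).
rewrite [v \in _]inE => /orP[/ih /(_ vA)[e eB <-]|/imsetP[e]].
  by exists e => //; apply: BB.
by rewrite !inE andbT => eB ->; exists e => //; apply: BB.
Qed.

Section Pair.
Variables (x y : V) (J : nat).
(** The radius leaves room for a separating word of length at most 3 followed by words of length at
    most [J]. *)
Let A := iter (J + 3) nb [set x; y].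
Hypothesis xy : x != y.
Hypothesis expA : (2 * #|A| <= #|nb A|)%N.
Hypothesis expx : (2 <= #|nb [set x]|)%N.
Hypothesis expy : (2 <= #|nb [set y]|)%N.

Let Rt := [:: x; y].

(* A spanning forest of the states reachable from [x] and [y]: each of them but [x]
   and [y] keeps one incoming arrow, out of [x] or [y] whenever possible. *)
Let parent v : option arrow :=
  if [pick e | (e.1 \in Rt) && (d e == v)] is Some e then Some e
  else [pick e | (e.1 \in A) && (d e == v)].

Let tree (e : arrow) := [&& e.1 \in A, d e \notin Rt & parent (d e) == Some e].
Let N := [set e : arrow | (e.1 \in A) && ~~ tree e].

Let RtA r : r \in Rt -> r \in A.
Proof.
move=> rR; apply: (fintype.subsetP (sub_iter_nb _ (leq0n _))).
by rewrite /= !inE in rR *.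
Qed.

Let parentE e : e.1 \in A -> exists2 e', parent (d e) = Some e' & (e'.1 \in A) /\ d e' = d e.
Proof.
move=> eA; rewrite /parent; case: pickP => [e' /andP[/RtA e'A /eqP]|_]; first by exists e'.
case: pickP => [e' /andP[e'A /eqP]|/(_ e)]; first by exists e'.
by rewrite eA eqxx.
Qed.

Let tree_inj e e' : tree e -> tree e' -> d e = d e' -> e = e'.
Proof.
by move=> /and3P[_ _ /eqP pe] /and3P[_ _ /eqP pe'] dE; apply: Some_inj; rewrite -pe dE.
Qed.

Let tree_root e : tree e -> d e \notin Rt.
Proof. by case/and3P. Qed.

(** This is what the preference for parents out of [x] or [y] is for: a root arrow that is not the
    parent of its target was displaced by another root arrow. *)
Let root_twin e : e \in N -> e.1 \in Rt -> d e \notin Rt ->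
  exists2 e', tree e' & (e'.1 \in Rt) /\ d e' = d e.
Proof.
rewrite inE => /andP[eA _] eR dR.
have [e' pe'] : exists2 e', parent (d e) = Some e' & (e'.1 \in Rt) /\ d e' = d e.
  rewrite /parent; case: pickP => [e' /andP[e'R /eqP]|/(_ e)]; first by exists e'.
  by rewrite eR eqxx.
move=> [e'R dE]; exists e' => //.
by rewrite /tree RtA// dE dR pe' eqxx.
Qed.

(** Of the [2 * #|A|] arrows out of [A], the forest keeps one for each state of [nb A] other than
    [x] and [y], hence at least [2 * #|A| - 2] by expansion. *)
Let cardN : (#|N| <= 2)%N.
Proof.
pose T := [set e | tree e].
have cT : (#|nb A| <= 2 + #|T|)%N.
  have -> : #|T| = #|[set d e | e in T]|.
    by rewrite card_in_imset// => e e'; rewrite !inE; exact: tree_inj.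
  have -> : 2%N = #|[set x; y]| by rewrite cards2 xy.
  apply: leq_trans (leq_card_setU _ _); apply/subset_leq_card/fintype.subsetP => v vB.
  rewrite inE; case: (boolP (v \in [set x; y])) => //= vR; apply/imsetP.
  have [e eA ev] : exists2 e, e.1 \in A & d e = v.
    move: vB; rewrite [v \in nb A]inE => /orP[/iter_nb_target /(_ vR)//|/imsetP[e]].
    by rewrite !inE andbT => eA ->; exists e.
  have [e' pe' [e'A dE]] := parentE eA; exists e'; last by rewrite dE.
  by rewrite inE /tree e'A dE pe' eqxx andbT ev; move: vR; rewrite !inE.
have : (#|N| + #|T| <= 2 * #|A|)%N.
  have -> : (2 * #|A|)%N = #|finset.setX A [set: letter]|.
    by rewrite cardsX cardsT card_bool mulnC.
  rewrite -cardsUI [X in (_ + X)%N](_ : _ = 0%N).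
    rewrite addn0; apply/subset_leq_card/fintype.subsetP => e; rewrite !inE andbT.
    by case/orP => [/andP[]|/and3P[]].
  by apply/eqP; rewrite cards_eq0; apply/eqP/finset.setP => e; rewrite !inE; case: (tree e); rewrite ?andbF.
lia.
Qed.

Let tree_walk_inj r r' w w' : r \in Rt -> r' \in Rt ->
  all tree (walk d r w) -> all tree (walk d r' w') -> run d w r = run d w' r' ->
  r = r' /\ w = w'.
Proof.
by apply: (@walk_inj n d tree tree (mem Rt)) => //; exact: tree_inj.
Qed.

Let clean_nodes ra ga rb gb : ra \in Rt -> rb \in Rt ->
  (forall w, (size w <= J)%N -> all tree (walk d ra (ga ++ w))) ->
  (forall w, (size w <= J)%N -> all tree (walk d rb (gb ++ w))) ->
  (forall w w', ra = rb -> ga ++ w <> gb ++ w') ->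
  clean J (run d ga ra) (run d gb rb).
Proof.
move=> Ra Rb ta tb ab; split.
  apply/eqP => E.
  have [||r w] := tree_walk_inj Ra Rb _ _ E.
  - by rewrite -[ga]cats0 ta.
  - by rewrite -[gb]cats0 tb.
  by apply: (ab [::] [::] r); rewrite !cats0.
move=> r r' w w'; rewrite !inE => /orP[]/eqP-> /orP[]/eqP-> sw sw'; rewrite -!run_cat => E.
- have [_ /eqP] := tree_walk_inj Ra Ra (ta _ sw) (ta _ sw') E.
  by rewrite eqseq_cat// eqxx /= => /eqP.
- by have [rE wE] := tree_walk_inj Ra Rb (ta _ sw) (tb _ sw') E; case: (ab w w' rE wE).
- have [rE wE] := tree_walk_inj Rb Ra (tb _ sw) (ta _ sw') E.
  by case: (ab w' w (esym rE) (esym wE)).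
- have [_ /eqP] := tree_walk_inj Rb Rb (tb _ sw) (tb _ sw') E.
  by rewrite eqseq_cat// eqxx /= => /eqP.
Qed.

(** A tree walk followed by its first non-tree arrow. Different words [rcons g c] end in different
    arrows of [N], so at most two of them occur. *)
Let bad r g c := [/\ r \in Rt, all tree (walk d r g) & (run d g r, c) \in N].

Let bad_inj r g c r' g' c' : bad r g c -> bad r' g' c' ->
  (run d g r, c) = (run d g' r', c') -> rcons g c = rcons g' c'.
Proof.
move=> [Rr tg _] [Rr' tg' _] [E ->].
by have [_ ->] := tree_walk_inj Rr Rr' tg tg' E.
Qed.

Let first_bad r w : r \in Rt -> (size w <= J + 3)%N -> ~~ all tree (walk d r w) ->
  exists g c, bad r g c /\ prefix (rcons g c) w.
Proof.
move=> rR; elim/last_ind: w => // w c ih; rewrite size_rcons => sw.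
rewrite walk_rcons all_rcons negb_and.
have [tw|] := boolP (all tree (walk d r w)); last first.
  move=> /(ih (ltnW sw))[g [c' [b p]]] _; exists g, c'; split=> //.
  by apply: prefix_trans p _; exact: prefix_rcons.
rewrite orbF => nt; exists w, c; split; last exact: prefix_refl.
split=> //; rewrite inE nt andbT /=; apply: run_iter_nb; last by rewrite ltnW.
by rewrite !inE in rR *.
Qed.

Let good w := forall r w', r \in Rt -> (size w' <= J)%N -> all tree (walk d r (w ++ w')).

Let good_clean w : good w -> clean J (run d w x) (run d w y).
Proof.
move=> gw; apply: clean_nodes; rewrite ?inE ?eqxx ?orbT//.
- by move=> w' sw; apply: gw => //; rewrite inE eqxx.
- by move=> w' sw; apply: gw => //; rewrite !inE eqxx orbT.
- by move=> w' w'' xy'; move: xy; rewrite xy' eqxx.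
Qed.

Let not_good c1 c2 : ~ good [:: c1; c2] ->
  exists r g c, bad r g c /\ (rcons g c = [:: c1] \/ take 2 (rcons g c) = [:: c1; c2]).
Proof.
move=> /existsNP[r /existsNP[w' /not_implyP[rR /not_implyP[sw /negP nt]]]].
have [] := first_bad rR _ nt; first by rewrite /= addn3 !ltnS leqW.
move=> g [c [b p]]; exists r, g, c; split=> //.
case: g b p => [|c' g] b /=; first by move=> /andP[/eqP -> _]; left.
move=> /andP[/eqP -> p]; right; congr cons.
by case: g b p => [|c'' g] b /= /andP[/eqP ->]; rewrite ?take0.
Qed.

(** The four words of length 2 are blocked by at most two arrows. An arrow met after one letter or
    more blocks only one of them, so both letters must be blocked at a root. *)
Let stuck : (forall c1 c2, ~ good [:: c1; c2]) ->
  exists2 r, r \in Rt & exists2 s, s \in Rt & N = [set (r, false); (s, true)].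
Proof.
move=> ng.
have key c : exists r, bad r [::] c.
  have [r1 [g1 [c1 [b1 h1]]]] := not_good (ng c false).
  case: h1 => h1.
    by case: g1 h1 b1 => [[->]|? [|]//]; exists r1.
  have [r2 [g2 [c2 [b2 h2]]]] := not_good (ng c true).
  case: h2 => h2.
    by case: g2 h2 b2 => [[->]|? [|]//]; exists r2.
  (* Blocking both extensions of [c] separately already takes two arrows, and the other letter
     requires a third. *)
  have [r3 [g3 [c3 [b3 h3]]]] := not_good (ng (~~ c) true).
  have hd3 : head c (rcons g3 c3) = ~~ c.
    by case: h3 => [->//|]; case: (rcons g3 c3) => // ? ? [->].
  exfalso; have ne r g e r' g' e' : bad r g e -> bad r' g' e' ->
     rcons g e <> rcons g' e' -> (run d g r, e) != (run d g' r', e').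
    by move=> B B' gg; apply/eqP => /(bad_inj B B').
  have n12 : rcons g1 c1 <> rcons g2 c2 by move=> E; rewrite E h2 in h1.
  have hh (w : word) b : head c w = ~~ c -> take 2 w = [:: c; b] -> False.
    case: w => [|a l] /=; first by case: (c).
    by move=> -> [+ _]; case: (c).
  have n13 : rcons g1 c1 <> rcons g3 c3.
    by move=> E; rewrite E in h1; exact: (hh _ _ hd3 h1).
  have n23 : rcons g2 c2 <> rcons g3 c3.
    by move=> E; rewrite E in h2; exact: (hh _ _ hd3 h2).
  have u3 : uniq [:: (run d g1 r1, c1); (run d g2 r2, c2); (run d g3 r3, c3)].
    by rewrite /= !inE negb_or !ne.
  have : (size [:: (run d g1 r1, c1); (run d g2 r2, c2); (run d g3 r3, c3)] <= size (enum N))%N.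
    apply: uniq_leq_size => // e; rewrite mem_enum !inE.
    by case: b1 b2 b3 => [_ _ +] [_ _ +] [_ _ +]; rewrite !inE => N1 N2 N3 /or3P[]/eqP->.
  by rewrite -cardE => /leq_trans /(_ cardN).
have [r [rR _ rN]] := key false; have [s [sR _ sN]] := key true.
exists r => //; exists s => //; apply/eqP; rewrite eq_sym eqEcard cards2.
rewrite (leq_trans cardN) ?andbT//.
  by apply/fintype.subsetP => e /set2P[->|->]; [exact: rN|exact: sN].
by rewrite xpair_eqE andbF.
Qed.

(** All lost arrows leave roots, and a tree arrow never enters a root, so a walk that starts with a
    tree arrow stays in the forest. *)
Let stuck_walk r s c g w : r \in Rt -> s \in Rt -> N = [set (r, false); (s, true)] ->
  c \in Rt -> (c, head false g) \notin N -> (0 < size g)%N -> (size g <= 3)%N ->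
  (size w <= J)%N -> all tree (walk d c (g ++ w)).
Proof.
move=> rR sR NE cR; case: g => // b g /= cb _ sg sw.
have step e k : e.1 \in iter k nb [set x; y] -> (k <= J + 3)%N -> e \notin N -> tree e.
  move=> eA kJ; rewrite inE negb_and negbK => /orP[|//].
  by rewrite (fintype.subsetP (sub_iter_nb _ kJ) _ eA).
have cA : c \in [set x; y] by rewrite !inE in cR *.
have t0 : tree (c, b) by apply: (step _ 0%N).
rewrite t0 /=.
suff H u v k : v \notin Rt -> v \in iter k nb [set x; y] -> (size u + k <= J + 3)%N ->
    all tree (walk d v u).
  apply: (H _ _ 1%N); [exact: tree_root|exact: mem_nb|by rewrite size_cat addn1 -addSn [(J + 3)%N]addnC leq_add].
elim: u v k => //= b' u ih v k vR vk uk.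
have tv : tree (v, b').
  apply: (step _ k) => //=; first by lia.
  rewrite NE !inE !xpair_eqE; apply: contra vR.
  by case/orP => /andP[/eqP-> _].
rewrite tv /=; apply: (ih _ k.+1) => //; first exact: tree_root.
  by rewrite iterS; exact: mem_nb.
by lia.
Qed.

Let expR r : r \in Rt -> exists c, d (r, c) != r.
Proof.
move=> rR; have : (2 <= #|nb [set r]|)%N.
  by move: rR; rewrite !inE => /orP[]/eqP->.
rewrite ltnNge => h; apply/not_existsP => h'; case/negP: h.
rewrite -(cards1 r); apply/subset_leq_card/fintype.subsetP => v.
rewrite inE => /orP[//|/imsetP[[r' c]]]; rewrite !inE andbT /= => /eqP-> ->.
by move/negP: (h' c); rewrite negbK.
Qed.

Let two0 q r s : q \in Rt -> r \in Rt -> s \in Rt -> r != s -> q = r \/ q = s.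
Proof.
rewrite !inE => /orP[]/eqP-> /orP[]/eqP-> /orP[]/eqP->; rewrite ?eqxx// => _;
  by [left|right].
Qed.

(** When no word of length 2 is good, the two lost arrows leave [x] or [y]. One that leads outside
    the roots has a twin in the forest, from which the walk can be read instead; one that leads to a
    root only moves within [x] and [y]. Every case ends in a merge or in two disjoint branches of
    the forest. *)
Lemma clean_descendant : exists2 w, (size w <= 3)%N &
  run d w x = run d w y \/ clean J (run d w x) (run d w y).
Proof.
have [[c1 [c2 gw]]|ng] := pselect (exists c1 c2, good [:: c1; c2]).
  by exists [:: c1; c2] => //; right; exact: good_clean.
have {}ng c1 c2 : ~ good [:: c1; c2] by move=> g; apply: ng; exists c1, c2.
pose goal u v := exists2 w, (size w <= 3)%N &
  run d w u = run d w v \/ clean J (run d w u) (run d w v).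
have out r t : r \in Rt -> t \in Rt -> r != t -> goal r t -> goal x y.
  rewrite !inE => /orP[]/eqP-> /orP[]/eqP->; rewrite ?eqxx// => _ [w sw EC].
  by exists w => //; case: EC => [->|/clean_sym]; [left|right].
have [r rR [s sR NE]] := stuck ng.
have cl ra ga rb gb : ra \in Rt -> rb \in Rt ->
    (ra, head false ga) \notin N -> (rb, head false gb) \notin N ->
    (0 < size ga <= 3)%N -> (0 < size gb <= 3)%N ->
    (forall w w', ra = rb -> ga ++ w <> gb ++ w') ->
    clean J (run d ga ra) (run d gb rb).
  move=> Ra Rb na nb' /andP[a0 a3] /andP[b0 b3]; apply: clean_nodes => // w sw.
    exact: (stuck_walk rR sR).
  exact: (stuck_walk rR sR).
have treeN e : tree e -> e \notin N by rewrite !inE negb_and negbK orbC => ->.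
(* Either one root loses both its arrows and the other none, or each root loses one. *)
have [rs|rs] := eqVneq r s.
  have [t tR tr] : exists2 t, t \in Rt & t != r.
    move: rR; rewrite inE => /predU1P[->|]; first by exists y; rewrite ?inE ?eqxx ?orbT// eq_sym.
    by rewrite inE => /eqP->; exists x; rewrite ?inE ?eqxx.
  have rt : r != t by rewrite eq_sym.
  apply: (out r t) => //.
  have rN c : (r, c) \in N by rewrite NE -rs !inE !xpair_eqE eqxx; case: (c).
  have tN c : (t, c) \notin N by rewrite NE -rs !inE !xpair_eqE (negPf tr).
  have [c cr] := expR rR.
  have [dR|dR] := boolP (d (r, c) \in Rt).
    have dt : d (r, c) = t.
      by have [dr|//] := two0 dR rR tR rt; rewrite dr eqxx in cr.
    exists [:: c; ~~ c] => //; right.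
    rewrite (_ : run d [:: c; ~~ c] r = run d [:: ~~ c] t); last by rewrite /run /= dt.
    by apply: cl => //= w w' _ []; case: (c).
  have [[t' c'] tt [t'R /= dE]] := root_twin (rN c) rR dR.
  have t't : t' = t.
    have [/= t'r|//] := two0 t'R rR tR rt.
    by have := treeN _ tt; rewrite t'r rN.
  rewrite {}t't in tt dE; exists [:: c] => //.
  have [cc|cc] := eqVneq c' c; first by left; rewrite /run /= -dE cc.
  right; rewrite (_ : run d [:: c] r = run d [:: c'] t); last by rewrite /run /= dE.
  by apply: cl => //= w w' _ [] cE; rewrite cE eqxx in cc.
apply: (out r s) => //.
have rT : (r, true) \notin N by rewrite NE !inE !xpair_eqE (negPf rs) andbF.
have sF : (s, false) \notin N by rewrite NE !inE !xpair_eqE andbF eq_sym (negPf rs).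
have rF : (r, false) \in N by rewrite NE !inE eqxx.
have sT : (s, true) \in N by rewrite NE !inE eqxx orbT.
have cross e : tree e -> e.1 \in Rt -> e = (r, true) \/ e = (s, false).
  case: e => q c te qR; have /= qrs := two0 qR rR sR rs.
  move: (treeN _ te); case: qrs => ->; case: c {te qR} => //.
  - by left.
  - by rewrite rF.
  - by rewrite sT.
  - by right.
have rsn w w' g g' : r = s -> g ++ w <> g' ++ w' :> word by move=> E; rewrite E eqxx in rs.
have [fR|fR] := boolP (d (r, false) \in Rt); last first.
  have [e te [eR /= dE]] := root_twin rF rR fR.
  exists [:: false] => //; case: (cross e te eR) => eE; rewrite eE in dE.
    right; rewrite (_ : run d [:: false] r = run d [:: true] r); last by rewrite /run /= dE.
    by apply: cl => //= w w'; exact: (rsn _ _ [:: _] [:: _]).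
  by left; rewrite /run /= dE.
have [hR|hR] := boolP (d (s, true) \in Rt); last first.
  have [e te [eR /= dE]] := root_twin sT sR hR.
  exists [:: true] => //; case: (cross e te eR) => eE; rewrite eE in dE.
    by left; rewrite /run /= dE.
  right; rewrite (_ : run d [:: true] s = run d [:: false] s); last by rewrite /run /= dE.
  by apply: cl => //= w w'; exact: (rsn _ _ [:: _] [:: _]).
have two q : q \in Rt -> q = r \/ q = s by move=> qR; exact: two0.
have [fE|fE] := two _ fR.
  exists [:: false; true] => //; right.
  rewrite (_ : run d [:: false; true] r = run d [:: true] r); last by rewrite /run /= fE.
  by apply: cl => //= w w'; exact: (rsn _ _ [:: _] [:: _; _]).
have [hE|hE] := two _ hR; last first.
  exists [:: true; false] => //; right.
  rewrite (_ : run d [:: true; false] s = run d [:: false] s); last by rewrite /run /= hE.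
  by apply: cl => //= w w'; exact: (rsn _ _ [:: _; _] [:: _]).
(* The lost arrows form the cycle [r -> s -> r], and a further letter is needed to leave it: the
   only case of length 3. *)
exists [:: false; true; true] => //; right.
rewrite (_ : run d [:: false; true; true] r = run d [:: true] r); last by rewrite /run /= fE hE.
by apply: cl => //= w w'; exact: (rsn _ _ [:: _] [:: _; _; _]).
Qed.

End Pair.
End CleanPairs.

(** * Expansion of small sets *)

Section Expansion.
Variable R : realType.

Lemma Pr_into (A V : finType) (Q : {set A}) (B : {set V}) : (0 < #|V|)%N ->
  Pr R (fun h : {ffun A -> V} => [forall e in Q, h e \in B]) =
  (#|B|%:R / #|V|%:R) ^+ #|Q|.
Proof.
move=> V0; rewrite PrE.
have -> : #|(fun h : {ffun A -> V} => [forall e in Q, h e \in B])| =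
    (#|B| ^ #|Q| * #|V| ^ #|~: Q|)%N.
  pose F e := if e \in Q then mem B else mem (finset.setT : {set V}).
  transitivity #|family F|.
    apply: eq_card => h; rewrite [LHS]unfold_in; apply/forallP/familyP => H e; have := H e;
      by rewrite /F; case: (e \in Q).
  rewrite card_family foldrE big_map big_enum /= (bigID (mem Q)) /= -!prod_nat_const.
  congr (_ * _)%N; first by apply: eq_bigr => e; rewrite /F => ->.
  apply: eq_big => e; first by rewrite inE.
  by rewrite /F => /negPf ->; rewrite cardsT.
have -> : #|{ffun A -> V}| = (#|V| ^ #|Q| * #|V| ^ #|~: Q|)%N.
  by rewrite card_ffun -expnD cardsC.
rewrite !natrM invfM mulrACA divff ?mulr1 ?pnatr_eq0 -?lt0n ?expn_gt0 ?V0//.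
by rewrite !natrX expr_div_n.
Qed.

Lemma bin_leq_exp n m : ('C(n, m) <= n ^ m)%N.
Proof.
have : (n ^_ m <= n ^ m)%N.
  by elim: m => // m ih; rewrite ffactnSr expnSr leq_mul// leq_subr.
by apply: leq_trans; rewrite -bin_ffact leq_pmulr// fact_gt0.
Qed.

(** A failing [A] sends its [2 * #|A|] arrows into a set [B] of size [m < 2 * #|A|]. At most [n ^ m]
    choices of [B] face a probability of order [n ^ -(m + 1)]; the sets [A] inside [B] are boundedly
    many. *)
Lemma Pr_not_expanding n s0 : (0 < n)%N ->
  Pr R (fun d : automaton n => [exists A : {set 'I_n},
     (0 < #|A| <= s0)%N && (#|nb d A| < 2 * #|A|)%N]) <=
  ((2 * s0).+1 * (4 ^ s0 * (2 * s0) ^ (2 * s0)))%:R / n%:R.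
Proof.
move=> n0; set K := ((2 * s0) ^ (2 * s0))%N.
have nn0 : 0 < n%:R :> R by rewrite ltr0n.
have V0 : (0 < #|'I_n|)%N by rewrite card_ord.
pose P (z : {set 'I_n} * {set 'I_n}) :=
  [&& z.1 \subset z.2, (0 < #|z.1|)%N, (#|z.1| <= s0)%N & (#|z.2| < 2 * #|z.1|)%N].
pose E (z : {set 'I_n} * {set 'I_n}) (d : automaton n) :=
  [forall e in finset.setX z.1 [set: letter], d e \in z.2].
apply: (@le_trans _ _ (Pr R (fun d => [exists z, P z && E z d]))).
  apply: le_Pr => d /existsP[A /andP[/andP[A0 As] An]]; apply/existsP; exists (A, nb d A).
  rewrite /P /= subset_nb A0 As An /=; apply/forallP => -[p c]; apply/implyP.
  by move=> /finset.setXP[pA _]; exact: (@mem_nb n d A (p, c)).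
apply: le_trans (Pr_exists _ _ _) _.
have bnd z : P z -> Pr R (E z) <= K%:R / n%:R ^+ #|z.2|.+1.
  case/and4P => _ z0 zs zz; rewrite Pr_into// card_ord cardsX cardsT card_bool.
  rewrite expr_div_n; apply: ler_pM; rewrite ?invr_ge0 ?exprn_ge0//.
    rewrite -natrX ler_nat; apply: (@leq_trans ((2 * s0) ^ (#|z.1| * 2))).
      rewrite leq_exp2r ?muln_gt0 ?z0//.
      by apply: leq_trans (ltnW zz) _; rewrite leq_mul2l zs.
    by rewrite leq_pexp2l 1?mulnC ?leq_mul2l ?zs// muln_gt0 (leq_trans z0).
  by rewrite lef_pV2 ?posrE ?exprn_gt0// -!natrX ler_nat leq_pexp2l// mulnC.
apply: le_trans (ler_sum _ bnd) _.
pose c (B : {set 'I_n}) : R := K%:R / n%:R ^+ #|B|.+1.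
have c0 B : 0 <= c B by rewrite divr_ge0 ?exprn_ge0.
apply: (@le_trans _ _ (\sum_(B : {set 'I_n} | (#|B| <= 2 * s0)%N) \sum_(A : {set 'I_n} | A \subset B) c B)).
  pose sw (z : {set 'I_n} * {set 'I_n}) := (z.2, z.1).
  have swK : involutive sw by case.
  rewrite pair_big_dep /= (reindex_inj (inv_inj swK)) /=.
  rewrite big_mkcond [leRHS]big_mkcond /=; apply: ler_sum => -[B A] _ /=.
  rewrite /P /=; case: ifP => [/and4P[AB A0 As BA]|_]; last by case: ifP.
  by rewrite AB ifT// andbT (leq_trans (ltnW BA))// leq_mul2l As.
apply: (@le_trans _ _ (\sum_(B : {set 'I_n} | (#|B| <= 2 * s0)%N) (4 ^ s0)%:R * c B)).
  apply: ler_sum => B sB; rewrite sumr_const -[leLHS]mulr_natl ler_wpM2r// ler_nat.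
  have -> : #|[pred A : {set 'I_n} | A \subset B]| = #|powerset B|.
    by apply: eq_card => A; rewrite !inE.
  by rewrite card_powerset -[4%N]/(2 ^ 2)%N -expnM leq_pexp2l.
rewrite (partition_big (fun B : {set 'I_n} => inord #|B| : 'I_(2 * s0).+1) predT)//=.
apply: (@le_trans _ _ (\sum_(m : 'I_(2 * s0).+1) ((4 ^ s0 * K)%:R / n%:R : R))); last first.
  by rewrite sumr_const card_ord -[leLHS]mulr_natl mulrA -natrM.
apply: ler_sum => m _.
rewrite (eq_bigr (fun=> (4 ^ s0)%:R * (K%:R / n%:R ^+ m.+1))); last first.
  by move=> B /andP[sB /eqP <-]; rewrite inordK.
rewrite sumr_const -[leLHS]mulr_natl natrM -[leRHS]mulrA mulrCA ler_wpM2l//.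
rewrite mulrCA ler_wpM2l// exprS invfM mulrCA -[leRHS]mulr1 ler_wpM2l ?invr_ge0//.
rewrite ler_pdivrMr ?exprn_gt0// mul1r -natrX ler_nat.
apply: leq_trans (bin_leq_exp n m); have := card_draws 'I_n m; rewrite card_ord => <-.
apply: subset_leq_card.
apply/fintype.subsetP => B; rewrite !inE => /andP[sB /eqP <-].
by rewrite inordK.
Qed.

End Expansion.

(** * Forward exploration of a pair *)

Section IndependentValues.
Variables (R : realType) (A V : finType).
Hypothesis V0 : (0 < #|V|)%N.
Let T0 : (0 < #|{ffun A -> V}|)%N.
Proof. by rewrite card_ffun expn_gt0 V0. Qed.

Lemma Ex_swap (T T' : finType) (f : T -> T' -> R) :
  Ex (fun t => Ex (f t)) = Ex (fun t' => Ex (f^~ t')).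
Proof.
rewrite /Ex -!mulr_suml exchange_big /=.
by rewrite -!mulrA [_^-1 * _]mulrC.
Qed.

Lemma Ex_split (e : A) (f : {ffun A -> V} -> R) :
  Ex f = Ex (fun h' => Ex (fun h => f (mix (pred1 e) h h'))).
Proof. by rewrite Ex_swap; apply: (@Ex_mix R A V (fun=> pred1 e)). Qed.

Fixpoint repeats (seen l : seq V) : nat :=
  if l is v :: l' then ((v \in seen) + repeats (v :: seen) l')%N else 0%N.

(** Given the values before it, each value is a repeat with probability at most
    [(size seen + size q) / #|V|], so it multiplies the exponential moment by at most one factor of
    the right-hand side. *)
Lemma repeats_moment (lam : R) (q : seq A) (seen : seq V) : 0 <= lam -> uniq q ->
  Ex (fun h : {ffun A -> V} => (1 + lam) ^+ repeats seen [seq h e | e <- q]) <=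
  (1 + lam * (size seen + size q)%:R / #|V|%:R) ^+ size q.
Proof.
move=> lam0; elim: q seen => [|e q ih] seen /=; first by rewrite Ex_cst// expr0.
move=> /andP[eq uq]; have v0 : 0 <= #|V|%:R^-1 :> R by rewrite invr_ge0.
rewrite (Ex_split e); set B := 1 + lam * _ / _.
have B1 : 1 <= B by rewrite /B lerDl !mulr_ge0.
apply: (@le_trans _ _ (Ex (fun h' : {ffun A -> V} =>
    (1 + lam) ^+ (h' e \in seen) * B ^+ size q))).
  apply: le_Ex => h'.
  rewrite (eq_Ex (g := fun h : {ffun A -> V} => (1 + lam) ^+ (h' e \in seen) *
     (1 + lam) ^+ repeats (h' e :: seen) [seq h e | e <- q])); last first.
    move=> h; rewrite mixl//= exprD; congr (_ * _ ^+ repeats _ _).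
    apply/eq_in_map => g gq; rewrite mixr//=.
    by apply: contraNneq eq => <-.
  rewrite ExZ ler_wpM2l ?exprn_ge0 ?addr_ge0//.
  by apply: le_trans (ih _ uq) _; rewrite /= addSn -addnS.
rewrite ExZr exprS ler_wpM2r ?exprn_ge0 ?(le_trans ler01)//.
rewrite (Ex_coord e (fun v => (1 + lam) ^+ (v \in seen)))//.
apply: (@le_trans _ _ (1 + lam * (size seen)%:R / #|V|%:R)); last first.
  by rewrite lerD2l ler_wpM2r// ler_wpM2l// ler_nat leq_addr.
rewrite /Ex ler_pdivrMr ?ltr0n// mulrDl mul1r mulfVK ?pnatr_eq0 -?lt0n//.
rewrite (eq_bigr (fun v => 1 + lam * (v \in seen)%:R)); last first.
  by move=> v _; case: (v \in seen); rewrite ?mulr1 ?mulr0 ?addr0 ?expr1.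
rewrite big_split /= sumr_const -mulr_sumr lerD2l ler_wpM2l//.
rewrite -natr_sum ler_nat.
have -> : (\sum_v (v \in seen) = #|seen|)%N.
  by rewrite -sum1_card [RHS]big_mkcond; apply: eq_bigr => v _; case: ifP.
exact: card_size.
Qed.

Lemma Pr_two_coord (e f : A) (S : {set V * V}) : e != f ->
  Pr R (fun h : {ffun A -> V} => (h e, h f) \notin S) = 1 - #|S|%:R / #|V|%:R ^+ 2.
Proof.
move=> ef; rewrite /Pr.
have -> : Ex (fun h : {ffun A -> V} => ((h e, h f) \notin S)%:R) =
   Ex (fun v : V => Ex (fun v' : V => ((v, v') \notin S)%:R)) :> R.
  rewrite (Ex_split e) -(Ex_coord e (fun v => Ex (fun v' : V => ((v, v') \notin S)%:R)))//.
  apply: eq_Ex => h'; rewrite -(Ex_coord f (fun v' => ((h' e, v') \notin S)%:R))//.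
  by apply: eq_Ex => h; rewrite mixl//= mixr//= eq_sym.
rewrite /Ex -mulr_suml pair_bigA /= -mulrA -invfM -expr2.
have -> : \sum_p ((p.1, p.2) \notin S)%:R = #|V|%:R ^+ 2 - #|S|%:R :> R.
  have -> : #|V|%:R ^+ 2 = \sum_(p : V * V) 1 :> R.
    by rewrite sumr_const card_prod -natrX mulnn.
  have -> : #|S|%:R = \sum_p (p \in S)%:R :> R.
    rewrite -sum1_card natr_sum big_mkcond /=; apply: eq_bigr => p _.
    by case: ifP.
  by rewrite -sumrB; apply: eq_bigr => -[v v'] _ /=; case: (_ \in _); rewrite ?subrr ?subr0.
by rewrite mulrBl divff// expf_neq0// pnatr_eq0 -lt0n.
Qed.

Lemma Pr_all_miss (q : seq (A * A)) (S : {set V * V}) :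
  uniq (flatten [seq [:: p.1; p.2] | p <- q]) ->
  Pr R (fun h : {ffun A -> V} => all (fun p => (h p.1, h p.2) \notin S) q) =
  (1 - #|S|%:R / #|V|%:R ^+ 2) ^+ size q.
Proof.
elim: q => [|[e f] q ih] /=; first by rewrite /Pr Ex_cst// expr0.
rewrite inE negb_or => /and3P[/andP[ef eq] fq uq].
rewrite exprS -ih// -(Pr_two_coord S ef) /Pr -ExZr.
rewrite (@Ex_mix R A V (fun=> pred2 e f)) // Ex_swap; apply: eq_Ex => h'.
rewrite -ExZ; apply: eq_Ex => h.
have Qe : pred2 e f e by rewrite /= eqxx.
have Qf : pred2 e f f by rewrite /= eqxx orbT.
rewrite (mixl _ _ Qe) (mixl _ _ Qf) -natrM mulnb; congr (_ && _)%:R.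
apply/eq_in_all => -[g g'] gq /=.
have mq a b : (a, b) \in q -> a \in flatten [seq [:: p.1; p.2] | p <- q] /\
    b \in flatten [seq [:: p.1; p.2] | p <- q].
  by move=> abq; split; apply/flatten_mapP; exists (a, b); rewrite // !inE eqxx ?orbT.
have [gF g'F] := mq _ _ gq.
have nQ a : a \in flatten [seq [:: p.1; p.2] | p <- q] -> ~~ pred2 e f a.
  move=> aF; rewrite /= negb_or; apply/andP; split.
    by apply: contraNneq eq => <-.
  by apply: contraNneq fq => <-.
by rewrite !mixr// nQ.
Qed.

End IndependentValues.

(** * The tree of new pairs below two states *)

Section Exploration.
Variables (R : realType) (n : nat) (x y : 'I_n).
Notation V := 'I_n.
Notation arrow := (V * letter)%type.
Notation entry := (word * (V * V))%type.
Implicit Types (d : automaton n) (l : seq entry).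

Definition ends l : seq V := flatten [seq [:: e.2.1; e.2.2] | e <- l].

Definition children d l : seq entry :=
  flatten [seq [seq (rcons e.1 c, (d (e.2.1, c), d (e.2.2, c))) | c <- [:: false; true]]
          | e <- l].

Definition out_arrows l : seq arrow :=
  flatten [seq flatten [seq [:: (e.2.1, c); (e.2.2, c)] | c <- [:: false; true]] | e <- l].

(** The states of a rejected entry also count as seen, so a kept pair consists of states met for the
    first time. *)
Fixpoint keep_new (seen : seq V) l : seq entry :=
  if l is e :: l' then
    let r := keep_new (e.2.2 :: e.2.1 :: seen) l' in
    if (e.2.1 \notin seen) && (e.2.2 \notin e.2.1 :: seen) then e :: r else r
  else [::].

(* The words of length [j] along which the two walks from [x] and [y] only meet
   new states, together with the two states reached, and all the states seen so far. *)
Fixpoint explore d j : seq entry * seq V :=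
  if j is j'.+1 then
    let ls := explore d j' in
    let l' := children d ls.1 in (keep_new ls.2 l', ends l' ++ ls.2)
  else ([:: ([::], (x, y))], [:: x; y]).

Lemma ends_children d l : ends (children d l) = [seq d e | e <- out_arrows l].
Proof.
elim: l => // e l ih; rewrite /ends /children /out_arrows /= map_flatten in ih *.
by rewrite -ih.
Qed.

Lemma size_ends l : size (ends l) = (2 * size l)%N.
Proof. by elim: l => //= e l ih; rewrite ih mulnS. Qed.

Lemma size_children d l : size (children d l) = (2 * size l)%N.
Proof. by elim: l => //= e l ih; rewrite ih mulnS. Qed.

Lemma size_out_arrows l : size (out_arrows l) = (4 * size l)%N.
Proof. by elim: l => //= e l ih; rewrite ih mulnS. Qed.

Lemma size_keep_new seen l : (size l <= size (keep_new seen l) + repeats seen (ends l))%N.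
Proof.
elim: l seen => //= e l ih seen; have := ih (e.2.2 :: e.2.1 :: seen).
set k := keep_new _ _; set r := repeats _ _ => h.
case: (e.2.1 \in seen); case: (_ \in _) => /=; rewrite ?add0n ?addnA ?addn1 ?add1n ?addnS ?addSn ?addn0 ltnS//.
by rewrite (leq_trans h)// leqW.
Qed.

Lemma size_keep_new_le seen l : (size (keep_new seen l) <= size l)%N.
Proof.
elim: l seen => //= e l ih seen; have := ih (e.2.2 :: e.2.1 :: seen).
by case: ifP => _ /=; lia.
Qed.

Lemma keep_new_sub seen l : {subset keep_new seen l <= l}.
Proof.
elim: l seen => //= e l ih seen f.
case: ifP => _; last by move=> /ih fl; rewrite inE fl orbT.
by rewrite inE => /predU1P[->|/ih fl]; rewrite inE ?eqxx// fl orbT.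
Qed.

Lemma ends_sub l l' : {subset l <= l'} -> {subset ends l <= ends l'}.
Proof. by move=> ll v /flatten_mapP[e el ve]; apply/flatten_mapP; exists e; rewrite ?ll. Qed.

Lemma keep_new_uniq seen l :
  uniq (ends (keep_new seen l)) /\ {in ends (keep_new seen l), forall v, v \notin seen}.
Proof.
elim: l seen => //= e l ih seen.
have [u h] := ih (e.2.2 :: e.2.1 :: seen).
have h' v : v \in ends (keep_new (e.2.2 :: e.2.1 :: seen) l) -> v \notin seen.
  by move=> /h; rewrite !inE !negb_or => /and3P[].
case: ifP => [/andP[n1 n2]|_]; last by split.
rewrite /= in_cons negb_or in n2; case/andP: n2 => n2 n3; split.
  rewrite /ends /= -/(ends _) u inE negb_or eq_sym n2 andbT /=; apply/andP; split.
    by apply/negP => /h; rewrite !inE eqxx orbT.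
  by apply/negP => /h; rewrite !inE eqxx.
by move=> v; rewrite /ends /= -/(ends _) !inE => /or3P[/eqP->|/eqP->|/h'].
Qed.

Lemma explore_inv d j : let ls := explore d j in
  [/\ {in ls.1, forall e, [/\ size e.1 = j, run d e.1 x = e.2.1 & run d e.1 y = e.2.2]},
      (size ls.1 <= 2 ^ j)%N, (size ls.2 <= 4 * 2 ^ j)%N & {subset ends ls.1 <= ls.2}].
Proof.
elim: j => [|j [ih1 ih2 ih3 ih4]] /=.
  by split=> // e; rewrite inE => /eqP->.
set l := (explore d j).1 in ih1 ih2 ih3 ih4 *; set seen := (explore d j).2 in ih3 ih4 *.
split.
- move=> e /keep_new_sub /flatten_mapP[f fl /mapP[c _ ->]] /=.
  by have [<- <- <-] := ih1 _ fl; rewrite size_rcons !run_rcons.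
- by rewrite (leq_trans (size_keep_new_le _ _))// size_children expnS leq_mul2l.
- by rewrite size_cat size_ends size_children expnS; lia.
- by move=> v /(ends_sub (@keep_new_sub _ _)) vl; rewrite mem_cat vl.
Qed.

Lemma explore_uniq d j : x != y -> uniq (ends (explore d j).1).
Proof.
case: j => [|j] xy; first by rewrite /= inE xy.
by have [] := keep_new_uniq (explore d j).2 (children d (explore d j).1).
Qed.

Lemma explore_seen d i j : (i <= j)%N -> {subset (explore d i).2 <= (explore d j).2}.
Proof.
move=> /subnK <-; elim: (j - i)%N => // k ih v /ih vk.
by rewrite addSn /= mem_cat vk orbT.
Qed.

Lemma explore_new d i j : (i < j)%N ->
  {in ends (explore d j).1, forall v, v \notin (explore d i).2}.
Proof.
case: j => // j ij v vj.
have [_ /(_ v vj)] := keep_new_uniq (explore d j).2 (children d (explore d j).1).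
by apply: contra; apply: explore_seen.
Qed.

(** Reaching depth [j] reads no arrow out of the states kept there: they are new, hence distinct
    from the states whose arrows were read at smaller depths. The frontier may thus be resampled. *)
Lemma explore_stable d d' j :
  (forall e, e.1 \notin ends (explore d j).1 -> d' e = d e) ->
  forall i, (i <= j)%N -> explore d' i = explore d i.
Proof.
move=> dd'; elim=> //= i ih ij; rewrite ih ?(ltnW ij)//.
have -> // : children d' (explore d i).1 = children d (explore d i).1.
congr flatten; apply/eq_in_map => e ei; apply/eq_map => c.
have [_ _ _ sub] := explore_inv d i.
have nj v : v \in ends (explore d i).1 -> v \notin ends (explore d j).1.
  move=> /sub vi; apply/negP => /(explore_new ij).
  by rewrite vi.
by rewrite !dd'//=; apply: nj; apply/flatten_mapP; exists e; rewrite // !inE eqxx ?orbT.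
Qed.

Lemma uniq_out_arrows l : uniq (ends l) -> uniq (out_arrows l).
Proof.
have mo e (k : seq entry) : (e \in out_arrows k) -> e.1 \in ends k.
  move=> /flatten_mapP[f fk /flatten_mapP[c _]]; rewrite !inE => h.
  by apply/flatten_mapP; exists f => //; rewrite !inE; case/orP: h => /eqP->; rewrite eqxx ?orbT.
elim: l => //= e l ih; rewrite /ends /= -/(ends _) inE negb_or -andbA.
case/and4P => n12 n1 n2 /ih ->.
rewrite /out_arrows /= -/(out_arrows _) !inE !negb_or !xpair_eqE !andbF !andbT /=.
have N1 c : (e.2.1, c) \notin out_arrows l by apply: contra n1 => /mo.
have N2 c : (e.2.2, c) \notin out_arrows l by apply: contra n2 => /mo.
by rewrite !N1 !N2 n12.
Qed.

Hypothesis xy : x != y.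
Let n0 : (0 < #|V|)%N.
Proof. by apply/card_gt0P; exists x. Qed.

Definition frontier d j : pred arrow := fun e => e.1 \in ends (explore d j).1.

Lemma explore_mix d h j i : (i <= j)%N ->
  explore (mix (frontier d j) d h) i = explore d i.
Proof. by move=> ij; apply: explore_stable ij => e ne; rewrite mixr. Qed.

(** A lost pair costs a repeat among the fresh arrows, so [k] losses fall under an exponential
    Markov bound, with [lam] to be tuned by depth. The [8 * 2 ^ j] counts [4 * 2 ^ j] states seen
    and as many arrows to read. *)
Lemma Pr_level (lam : R) j t k : 0 <= lam ->
  Pr R (fun d => (t <= size (explore d j).1)%N && (size (explore d j.+1).1 + k <= 2 * t)%N) <=
  (1 + lam * (8 * 2 ^ j)%:R / n%:R) ^+ (4 * 2 ^ j) / (1 + lam) ^+ k.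
Proof.
move=> lam0; set B := 1 + lam * _ / _.
have lam1 : 0 < 1 + lam by rewrite ltr_pwDl.
have B1 : 1 <= B by rewrite /B lerDl !mulr_ge0 ?invr_ge0.
rewrite /Pr (@Ex_mix R _ _ (frontier^~ j)); last first.
  by move=> d h e; rewrite /frontier explore_mix.
have T0 : (0 < #|{: automaton n}|)%N by rewrite card_ffun expn_gt0 n0.
rewrite -[leRHS](@Ex_cst R {: automaton n} _ T0); apply: le_Ex => d.
set l := (explore d j).1; set seen := (explore d j).2.
have [_ sl ss _] := explore_inv d j.
apply: (@le_trans _ _ (Pr R (fun h : automaton n => (k <= repeats seen [seq h e | e <- out_arrows l])%N))).
  apply: le_Pr => h /andP[]; rewrite [explore _ j.+1]/= !explore_mix// -/l -/seen => tl.
  have := size_keep_new seen (children (mix (frontier d j) d h) l).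
  rewrite size_children ends_children.
  have -> : [seq (mix (frontier d j) d h) e | e <- out_arrows l] = [seq h e | e <- out_arrows l].
    apply/eq_in_map => e el; rewrite mixl// /frontier -/l.
    move: el => /flatten_mapP[f fl /flatten_mapP[c _]]; rewrite !inE => /orP[]/eqP->;
      by apply/flatten_mapP; exists f; rewrite // !inE eqxx ?orbT.
  by move: (size (keep_new _ _)) (repeats _ _) tl; move: (size l) => a b c; lia.
apply: le_trans (markov_Ex (f := fun h : automaton n => (1 + lam) ^+ repeats seen [seq h e | e <- out_arrows l]) (a := (1 + lam) ^+ k) _ _ _) _.
- by rewrite exprn_gt0.
- by move=> h; rewrite exprn_ge0 ?ltW.
- by move=> h kr; apply: ler_weXn2l => //; rewrite lerDl.
rewrite ler_wpM2r ?invr_ge0 ?exprn_ge0 ?(ltW lam1)//.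
apply: le_trans (repeats_moment n0 seen lam0 (uniq_out_arrows (explore_uniq d j xy))) _.
rewrite -/l size_out_arrows card_ord.
apply: (@le_trans _ _ (B ^+ (4 * size l))).
  rewrite lerXn2r ?nnegrE ?(le_trans ler01 B1)// ?addr_ge0 ?mulr_ge0 ?invr_ge0//.
  rewrite lerD2l ler_wpM2r ?invr_ge0// ler_wpM2l// ler_nat.
  by rewrite (leq_trans (leq_add ss (leq_mul (leqnn 4) sl)))// -mulnDl.
by apply: ler_weXn2l => //; rewrite leq_mul2l.
Qed.

(** The arrows labelled [false] out of the frontier are unread, so the pairs they lead to are
    independent and uniform; the target set ignores arrows out of [D] and is not moved by resampling
    them. *)
Lemma Pr_miss (S : automaton n -> {set V} -> {set V * V}) j M sg :
  (sg <= n ^ 2)%N ->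
  (forall d d' (D : {set V}), (forall e, e.1 \notin D -> d' e = d e) -> S d' D = S d D) ->
  Pr R (fun d => let l := (explore d j).1 in let D := [set v in ends l] in
    [&& (M <= size l)%N, (sg <= #|S d D|)%N &
        all (fun e => (d (e.2.1, false), d (e.2.2, false)) \notin S d D) l]) <=
  (1 - sg%:R / n%:R ^+ 2) ^+ M.
Proof.
move=> sgn Sst; have nn0 : 0 < n%:R :> R by rewrite ltr0n -(card_ord n).
rewrite /Pr (@Ex_mix R _ _ (frontier^~ j)); last first.
  by move=> d h e; rewrite /frontier explore_mix.
have T0 : (0 < #|{: automaton n}|)%N by rewrite card_ffun expn_gt0 n0.
rewrite -[leRHS](@Ex_cst R {: automaton n} _ T0); apply: le_Ex => d.
set l := (explore d j).1; set D := [set v in ends l].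
have SE h : S (mix (frontier d j) d h) D = S d D.
  by apply: Sst => e; rewrite inE => eD; rewrite mixr.
have [Ml|Ml] := leqP M (size l); last first.
  rewrite (eq_Ex (g := fun=> 0)) ?Ex_cst ?exprn_ge0 ?subr_ge0//.
    by rewrite ler_pdivrMr ?exprn_gt0// mul1r -natrX ler_nat.
  by move=> h; rewrite explore_mix// -/l leqNgt Ml.
have [Ss|Ss] := leqP sg #|S d D|; last first.
  rewrite (eq_Ex (g := fun=> 0)) ?Ex_cst ?exprn_ge0 ?subr_ge0//.
    by rewrite ler_pdivrMr ?exprn_gt0// mul1r -natrX ler_nat.
  by move=> h; rewrite explore_mix// -/l -/D SE [(sg <= _)%N]leqNgt Ss andbF.
pose q := [seq ((e.2.1, false), (e.2.2, false)) | e <- l].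
have uq : uniq (flatten [seq [:: p.1; p.2] | p <- q]).
  have -> : flatten [seq [:: p.1; p.2] | p <- q] = [seq (v, false) | v <- ends l].
    by rewrite /q /ends; elim: (l) => //= e k ->.
  by rewrite map_inj_uniq ?explore_uniq// => a b [].
apply: (@le_trans _ _ (Pr R (fun h : automaton n => all (fun p => (h p.1, h p.2) \notin S d D) q))).
  apply: le_Pr => h /and3P[_ _]; rewrite explore_mix// -/l -/D SE all_map.
  move=> /allP H; apply/allP => e el /=; have := H e el; rewrite !mixl//.
    by apply/flatten_mapP; exists e; rewrite // !inE eqxx orbT.
  by apply/flatten_mapP; exists e; rewrite // !inE eqxx.
have := Pr_all_miss R n0 (S d D) uq; rewrite size_map card_ord => ->.
have Sn : #|S d D|%:R / n%:R ^+ 2 <= 1 :> R.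
  rewrite ler_pdivrMr ?exprn_gt0// mul1r -natrX ler_nat.
  by rewrite (leq_trans (max_card _))// card_prod card_ord mulnn.
apply: (@le_trans _ _ ((1 - #|S d D|%:R / n%:R ^+ 2) ^+ M)).
  apply: ler_wiXn2l => //; by rewrite subr_ge0.
rewrite lerXn2r ?nnegrE ?subr_ge0//.
  apply: le_trans Sn; rewrite ler_wpM2r ?invr_ge0 ?exprn_ge0// ler_nat//.
by rewrite lerD2l lerN2 ler_wpM2r ?invr_ge0 ?exprn_ge0// ler_nat.
Qed.

End Exploration.

(** * Backward synchronisation *)

Lemma repeats0 (V : finType) (seen l : seq V) :
  uniq l -> {in l, forall v, v \notin seen} -> repeats seen l = 0%N.
Proof.
elim: l seen => //= v l ih seen /andP[vl ul] ls.
rewrite (negPf (ls v (mem_head _ _))) ih// => w wl; rewrite inE negb_or ls ?inE ?wl ?orbT// andbT.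
by apply: contraNneq vl => <-.
Qed.

(** * Exploration from a clean pair *)

Section CleanExploration.
Variables (n : nat) (x y : 'I_n) (d : automaton n) (J : nat).
Hypothesis cl : clean d J x y.

Lemma explore_clean j : (j <= J)%N -> size (explore x y d j).1 = (2 ^ j)%N.
Proof.
elim: j => // j ih jJ; have {}ih := ih (ltnW jJ).
have [sz _ _ _] := explore_inv x y d j.
have [xy inj] := cl.
set l := (explore x y d j).1 in ih sz *; set seen := (explore x y d j).2.
have seenP v : v \in seen -> exists r w, [/\ r \in [:: x; y], (size w <= j)%N & v = run d w r].
  rewrite /seen; elim: (j) v => [|i ihi] v /=.
    by move=> vxy; exists v, [::].
  rewrite mem_cat => /orP[|/ihi[r [w [rR wi vE]]]]; last by exists r, w; rewrite leqW.
  move=> /flatten_mapP[e /flatten_mapP[f fi /mapP[c _ ->]]] /=.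
  have [s1 <- <-] := (let: And4 h _ _ _ := explore_inv x y d i in h) f fi.
  rewrite -!run_rcons !inE => /orP[]/eqP->.
    by exists x, (rcons f.1 c); rewrite size_rcons s1 !inE eqxx.
  by exists y, (rcons f.1 c); rewrite size_rcons s1 !inE eqxx orbT.
have outP e : e \in out_arrows l -> exists r w, [/\ r \in [:: x; y], size w = j & e.1 = run d w r].
  move=> /flatten_mapP[f fl /flatten_mapP[c _]]; have [s1 e1 e2] := sz f fl.
  rewrite !inE => /orP[]/eqP-> /=.
    by exists x, f.1; rewrite s1 e1 !inE eqxx.
  by exists y, f.1; rewrite s1 e2 !inE eqxx orbT.
have sj (w : word) c : size w = j -> (size (rcons w c) <= J)%N.
  by rewrite size_rcons => ->.
have r0 : repeats seen (ends (children d l)) = 0%N.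
  rewrite ends_children; apply: repeats0.
    rewrite map_inj_in_uniq; first exact/uniq_out_arrows/explore_uniq.
    move=> e f /outP[r [w [rR wj eE]]] /outP[r' [w' [rR' wj' fE]]].
    case: e eE => s c /= ->; case: f fE => s' c' /= ->; rewrite -!run_rcons => E.
    have [-> /eqP] := inj r r' _ _ rR rR' (sj w c wj) (sj w' c' wj') E.
    by rewrite eqseq_rcons => /andP[/eqP-> /eqP->].
  move=> v /mapP[e /outP[r [w [rR wj eE]]] ->]; apply/negP => /seenP[r' [w' [rR' wj' E]]].
  case: e eE E => s c /= ->; rewrite -run_rcons => E.
  have [_ wE] := inj r r' _ _ rR rR' (sj w c wj) (leq_trans wj' (ltnW jJ)) E.
  by move: wj'; rewrite -wE size_rcons wj ltnn.
apply/eqP; rewrite eqn_leq; have [_ -> _ _] := explore_inv x y d j.+1.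
have := size_keep_new seen (children d l).
by rewrite r0 addn0 size_children ih -expnS.
Qed.

End CleanExploration.

(** * Counting the pairs merged by backward words *)

Section MergingPairs.
Variables (R : realType) (n : nat).
Hypothesis n0 : (0 < n)%N.
Notation V := 'I_n.
Implicit Types (d : automaton n) (w : word) (D A : {set V}).

Lemma sum_sqr_fibers (f : V -> V) A :
  #|[set z : V * V | [&& z.1 \in A, z.2 \in A & f z.1 == f z.2]]| =
  (\sum_s #|[set p in A | f p == s]| ^ 2)%N.
Proof.
rewrite -sum1_card (partition_big (fun z : V * V => f z.1) predT)//=.
apply: eq_bigr => s _; rewrite sum1_card -mulnn -cardsX; apply: eq_card => -[p q].
rewrite !inE /= unfold_in /= !inE /= andbC.
by case: eqP => [<-|]; rewrite ?andbF ?andbT// eq_sym; case: (p \in A).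
Qed.

Lemma sum_fibers (f : V -> V) A (B : {set V}) :
  (forall p, p \in A -> f p \in B) ->
  (\sum_(s in B) #|[set p in A | f p == s]| = #|A|)%N.
Proof.
move=> AB; rewrite -[RHS]sum1_card [RHS](partition_big f (mem B))//=.
by apply: eq_bigr => s _; rewrite -sum1_card; apply: eq_bigl => p; rewrite !inE.
Qed.

Definition merged d w : {set V * V} := [set z | run d w z.1 == run d w z.2].

Definition avoids d D p w := all (fun e => e.1 \notin D) (walk d p w).

(** A state of [D] with at most [th] preimages is paid by the term [th ^ 2], one with more by the
    square of its fibre, that is by merged pairs. *)
Lemma card_hitting d D w (th : nat) :
  (th * #|[set p | run d w p \in D]| <= th ^ 2 * #|D| + #|merged d w|)%N.
Proof.
set A := [set p | _].
have -> : #|A| = (\sum_(s in D) #|[set p in [set: V] | run d w p == s]|)%N.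
  rewrite -(@sum_fibers (fun p => run d w p) A D); last by move=> p; rewrite inE.
  apply: eq_bigr => s sD; apply: eq_card => p; rewrite !inE.
  by case: eqP => [->|]; rewrite ?sD// andbF.
have -> : #|merged d w| = (\sum_s #|[set p in [set: V] | run d w p == s]| ^ 2)%N.
  rewrite -sum_sqr_fibers; apply: eq_card => z; rewrite !inE; done.
rewrite big_distrr /=.
apply: (@leq_trans (\sum_(s in D) (th ^ 2 + #|[set p in [set: V] | run d w p == s]| ^ 2))).
  apply: leq_sum => s _; set m := #|_|; have [mt|mt] := leqP m th.
    by apply: leq_trans (leq_addr _ _); rewrite -mulnn leq_mul2l mt orbT.
  by apply: leq_trans (leq_addl _ _); rewrite -mulnn leq_mul2r ltnW ?orbT.
rewrite big_split /= sum_nat_const mulnC leq_add2l.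
by rewrite [leqRHS](bigID (mem D)) /= leq_addr.
Qed.

Variables (j0 k : nat).
Let h := (j0 + k)%N.
Notation U := (j0.-tuple bool).
Let long (u : U) : word := u ++ nseq k false.

Definition synced d D : {set V * V} :=
  [set z | [exists u : U, [&& avoids d D z.1 (long u), avoids d D z.2 (long u) &
     run d (long u) z.1 == run d (long u) z.2]]].

(** Merges inside [u] are excluded because words with a common prefix can share one, at the cost of
    a single collision. *)
Definition late d (z : V * V) (uu : U * U) :=
  [&& uu.1 != uu.2, run d uu.1 z.1 != run d uu.1 z.2, run d uu.2 z.1 != run d uu.2 z.2,
      run d (long uu.1) z.1 == run d (long uu.1) z.2 &
      run d (long uu.2) z.1 == run d (long uu.2) z.2].

Lemma synced_local d d' D : (forall e, e.1 \notin D -> d' e = d e) ->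
  synced d' D = synced d D.
Proof.
have H d1 d2 : (forall e, e.1 \notin D -> d1 e = d2 e) -> synced d2 D \subset synced d1 D.
  move=> dd; have run_eq p w : avoids d2 D p w -> avoids d1 D p w /\ run d1 w p = run d2 w p.
    move=> /allP a; split; last by apply: eq_run => e /a /dd.
    rewrite /avoids; have -> : walk d1 p w = walk d2 p w; last exact/allP.
    elim: w p a => //= c w ih p a; rewrite dd; last by apply: (a (p, c)); rewrite mem_head.
    by rewrite ih// => e ew; apply: a; rewrite inE ew orbT.
  apply/fintype.subsetP => z; rewrite !inE => /existsP[u /and3P[a1 a2 /eqP r]].
  apply/existsP; exists u; have [-> ->] := run_eq _ _ a1; have [-> ->] := run_eq _ _ a2.
  by rewrite r eqxx.
by move=> dd; apply/eqP; rewrite finset.eqEsubset !H// => e /dd.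
Qed.

(** The inequality [2 c m <= m ^ 2 + c ^ 2] on each fibre, summed over the image of [a^k], stands in
    for Cauchy-Schwarz and gives [c n] merges per word on average. Merges inside [u] cost [b1], and
    pairs merged by several words are paid by [late]. *)
Lemma synced_large d D (c dl b1 b2 th : nat) :
  (2 * c * #|[set run d (nseq k false) p | p : V]| <= n)%N ->
  (\sum_(u : U) #|merged d u| <= b1)%N ->
  (\sum_(u : U) \sum_(i < h) #|merged d (take i (long u))| <= b2)%N ->
  (\sum_(z : V * V) #|[set uu | late d z uu]| <= n)%N ->
  (#|D| <= dl)%N -> (0 < th)%N ->
  (4 * (2 ^ j0 * h * (th ^ 2 * dl) + b2) <= th * (2 ^ j0 * n))%N ->
  (c * 2 ^ j0 * n <= #|synced d D| + b1 + n)%N.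
Proof.
move=> Hc Hb1 Hb2 Hov HD th0 Hth.
set F := (2 ^ j0)%N in Hth *; set im := #|_| in Hc.
have cU : #|{: U}| = F by rewrite card_tuple card_bool.
pose Rd (u : U) := [set p | avoids d D p (long u)].
pose Z (u : U) := [set z : V * V | [&& z.1 \in Rd u, z.2 \in Rd u &
  run d (long u) z.1 == run d (long u) z.2]].
have szl (u : U) : size (long u) = h by rewrite size_cat size_tuple size_nseq.
(* On average over the words, at most a quarter of the starting states walk through [D]; a walk does
   so at one of its [h] prefixes, each handled by [card_hitting]. *)
have lost : (4 * \sum_(u : U) #|~: Rd u| <= F * n)%N.
  rewrite -(leq_pmul2l th0); apply: leq_trans Hth.
  rewrite mulnCA leq_mul2l big_distrr /=.
  apply: (@leq_trans (\sum_(u : U) \sum_(i < h) (th ^ 2 * #|D| + #|merged d (take i (long u))|))).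
    apply: leq_sum => u _.
    apply: (@leq_trans (th * \sum_(i < h) #|[set p | run d (take i (long u)) p \in D]|)); last first.
      by rewrite big_distrr; apply: leq_sum => i _; exact: card_hitting.
    rewrite leq_mul2l; apply/orP; right.
    apply: (@leq_trans #|\bigcup_(i < h) [set p | run d (take i (long u)) p \in D]|).
      apply/subset_leq_card/fintype.subsetP => p; rewrite !inE -has_predC.
      move=> /hasP[e /(nthP (p, false))[i]]; rewrite size_walk szl => ih <- /=.
      rewrite negbK nth_walk ?szl//= => pD; apply/bigcupP; exists (Ordinal ih) => //.
      by rewrite inE.
    elim/big_rec2: _ => [|i a B _ ih]; first by rewrite cards0.
    by apply: leq_trans (leq_card_setU _ _) _; rewrite leq_add2l.
  under eq_bigr do rewrite big_split /= sum_nat_const card_ord.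
  rewrite big_split /= sum_nat_const cU; apply: leq_add => //.
  by rewrite mulnA !leq_mul2l HD !orbT.
have ZR u : (2 * c * #|Rd u| <= #|Z u| + c ^ 2 * im)%N.
  rewrite /Z sum_sqr_fibers.
  rewrite -(@sum_fibers (fun p => run d (long u) p) (Rd u) [set run d (nseq k false) p | p : V]); last first.
    by move=> p _; rewrite run_cat; apply: imset_f.
  rewrite big_distrr /= [(_ * im)%N]mulnC /im -sum_nat_const.
  apply: (@leq_trans (\sum_(s in [set run d (nseq k false) p | p : V])
     (#|[set p in Rd u | run d (long u) p == s]| ^ 2 + c ^ 2))).
    by apply: leq_sum => s _; rewrite -mulnA addnC; exact: (nat_Cauchy c).
  rewrite big_split /= leq_add2r.
  by rewrite [leqRHS](bigID (mem [set run d (nseq k false) p | p : V])) /= leq_addr.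
(* At least [3/4] of the starts survive, so the main term is [(3/2) c F n]; the error [F c ^ 2 im]
   is at most half of [c F n]. *)
have sumZ : (c * F * n <= \sum_(u : U) #|Z u|)%N.
  have sR : (\sum_(u : U) #|Rd u| + \sum_(u : U) #|~: Rd u| = F * n)%N.
    rewrite -big_split /= -cU -sum_nat_const; apply: eq_bigr => u _.
    by rewrite cardsC card_ord.
  have : (\sum_(u : U) (2 * c * #|Rd u|) <= \sum_(u : U) (#|Z u| + c ^ 2 * im))%N.
    by apply: leq_sum => u _; exact: ZR.
  rewrite -big_distrr big_split /= sum_nat_const cU.
  move: lost sR; move: (\sum_(u : U) #|Rd u|)%N (\sum_(u : U) #|~: Rd u|)%N (\sum_(u : U) #|Z u|)%N.
  move=> s lo z lost sR le.
  have A1 : (c * (4 * lo) <= c * (F * n))%N by rewrite leq_mul2l lost orbT.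
  have A2 : (F * c * (2 * c * im) <= F * c * n)%N by rewrite leq_mul2l Hc orbT.
  have A3 : (c * (s + lo) = c * (F * n))%N by rewrite sR.
  by clear -A1 A2 A3 le; nia.
(* For a fixed pair, choose one word [u0] that merges it late: every further such word [u] gives a
   late couple [(u0, u)]. *)
have le : (\sum_(u : U) #|Z u| <= #|synced d D| + \sum_(u : U) #|merged d u| +
   \sum_(z : V * V) #|[set uu | late d z uu]|)%N.
  have cE (S : {set V * V}) : #|S| = (\sum_z (z \in S))%N.
    by rewrite -sum1_card big_mkcond; apply: eq_bigr => z _; case: ifP.
  rewrite (eq_bigr (fun u => \sum_z (z \in Z u))%N); last by move=> u _; rewrite cE.
  rewrite (eq_bigr (F1 := fun u : U => #|merged d u|) (fun u => \sum_z (z \in merged d u))%N); last first.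
    by move=> u _; rewrite cE.
  rewrite cE exchange_big /= [X in (_ + X + _)%N]exchange_big /= -!big_split /=.
  apply: leq_sum => z _.
  pose A := [set u : U | z \in Z u]; pose E := [set u : U | z \in merged d u].
  have -> : (\sum_(u : U) (z \in Z u) = #|A|)%N.
    by rewrite -sum1_card [RHS]big_mkcond; apply: eq_bigr => u _; rewrite [in RHS]inE; case: ifP.
  have -> : (\sum_(u : U) (z \in merged d u) = #|E|)%N.
    by rewrite -sum1_card [RHS]big_mkcond; apply: eq_bigr => u _; rewrite [in RHS]inE; case: ifP.
  have [->|[a aA]] := set_0Vmem A; first by rewrite cards0.
  have -> : z \in synced d D.
    by move: aA; rewrite !inE => h'; apply/existsP; exists a.
  have AE : (#|A| <= #|E| + #|A :\: E|)%N by rewrite -(cardsID E A) leq_add2r subset_leq_card ?finset.subsetIr.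
  suff : (#|A :\: E| <= 1 + #|[set uu | late d z uu]|)%N.
    by move=> h'; apply: leq_trans AE _; rewrite addnAC addnC leq_add2r.
  have [->|[u0 u0A]] := set_0Vmem (A :\: E); first by rewrite cards0.
  rewrite (cardsD1 u0) u0A leq_add2l.
  rewrite -(card_imset (mem ((A :\: E) :\ u0)) (f := fun u => (u0, u))); last by move=> u u' [].
  apply/subset_leq_card/fintype.subsetP => uu /imsetP[u]; rewrite !inE => /and3P[uu0 uE uA] ->.
  move: u0A; rewrite !inE => /andP[u0E u0A]; rewrite /late /= eq_sym uu0.
  by move: uA u0A => /and3P[_ _ ->] /and3P[_ _ ->]; rewrite u0E uE.
apply: leq_trans sumZ _; apply: leq_trans le _.
by rewrite leq_add// leq_add2l.
Qed.

Lemma Ex_card_merged w : Ex (fun d => #|merged d w|%:R) <=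
  n%:R * (1 + ((size w + size w) * (size w + size w + 2))%:R) :> R.
Proof.
set c := (_ * _)%N.
have nn0 : 0 < n%:R :> R by rewrite ltr0n.
have T0 : (0 < #|{: automaton n}|)%N by rewrite card_ffun card_ord expn_gt0 n0.
rewrite (eq_Ex (g := fun d => \sum_z ((run d w z.1 == run d w z.2)%:R : R))); last first.
  by move=> d; rewrite -natr_sum -sum1_card big_mkcond; congr _%:R; apply: eq_bigr => z _; rewrite inE; case: ifP.
rewrite Ex_sum -(pair_bigA _ (fun p q => Ex (fun d : automaton n => (run d w p == run d w q)%:R))) /=.
apply: (@le_trans _ _ (\sum_(p : V) (1 + c%:R))); last first.
  by rewrite sumr_const card_ord [leRHS]mulr_natl.
apply: ler_sum => p _; rewrite (bigD1 p)//=; apply: lerD; first exact: Pr_le1.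
apply: (@le_trans _ _ (\sum_(q : V) c%:R / n%:R)).
  rewrite big_mkcond; apply: ler_sum => q _; case: ifP => [qp|_]; last by rewrite divr_ge0.
  by apply: Pr_merge; rewrite // eq_sym.
by rewrite sumr_const card_ord -[leLHS]mulr_natr divfK// gt_eqF.
Qed.

(** The number [n ^ 2] of pairs is cancelled by the squared collision probability. *)
Lemma Ex_late : Ex (fun d => (\sum_(z : V * V) #|[set uu | late d z uu]|)%N%:R) <=
  ((2 ^ j0) ^ 2 * ((4 * h) * (4 * h + 2)) ^ 2)%:R :> R.
Proof.
have nn0 : 0 < n%:R :> R by rewrite ltr0n.
have T0 : (0 < #|{: automaton n}|)%N by rewrite card_ffun card_ord expn_gt0 n0.
set m := (4 * h * (4 * h + 2))%N.
rewrite (eq_Ex (g := fun d => \sum_z \sum_uu ((late d z uu)%:R : R))); last first.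
  move=> d; rewrite natr_sum; apply: eq_bigr => z _; rewrite -natr_sum.
  by rewrite -sum1_card big_mkcond; congr _%:R; apply: eq_bigr => uu _; rewrite inE; case: ifP.
rewrite Ex_sum; under eq_bigr do rewrite Ex_sum.
apply: (@le_trans _ _ (\sum_(z : V * V) \sum_(uu : U * U) (m%:R / n%:R) ^+ 2)).
  apply: ler_sum => z _; apply: ler_sum => -[u u'] _; rewrite /late /=.
  have [->|uu'] := eqVneq u u'.
    by rewrite (eq_Ex (g := fun=> 0)) ?Ex_cst ?exprn_ge0 ?divr_ge0// => d; rewrite eqxx.
  have [zz|zz] := eqVneq z.1 z.2.
    rewrite (eq_Ex (g := fun=> 0)) ?Ex_cst ?exprn_ge0 ?divr_ge0// => d.
    by rewrite zz eqxx andbF.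
  have uw : (u : word) != (u' : word) by rewrite val_eqE.
  have := @Pr_double_merge R n n0 z.1 z.2 u u' (nseq k false) j0 zz uw (size_tuple u) (size_tuple u').
  rewrite size_nseq -/h (_ : (h + h + (h + h) = 4 * h)%N); last by lia.
  by move=> le; refine (le_trans _ le); apply: le_Pr => d /andP[_].
rewrite !sumr_const !card_prod card_ord card_tuple card_bool.
rewrite -mulrnA -[leLHS]mulr_natl expr_div_n mulrA ler_pdivrMr ?exprn_gt0//.
rewrite -!natrX -!natrM ler_nat leq_eqVlt; apply/orP; left; apply/eqP.
by rewrite expnS expn1 [in RHS]expnS [(n ^ 2)%N]expnS !expn1; lia.
Qed.

End MergingPairs.

(** * Assembling the events *)

(* At most [loss l j] of the children of the live pairs of depth [j] may be lost:
   the losses weighted by [2 ^ - j] then sum to less than half of the tree. *)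
Definition loss (l j : nat) : nat := (7 + 2 ^ (j - (l + 3)))%N.

(* The number of live pairs guaranteed at depth [i + 5]. *)
Fixpoint alive (l i : nat) : nat :=
  if i is i'.+1 then (2 * alive l i' - loss l (i' + 5))%N else (2 ^ 5)%N.

Lemma div_mul_cancel (R : fieldType) (x a c : R) : c != 0 -> x / c * (a * c) = a * x.
Proof. by move=> c0; rewrite mulrCA divfK. Qed.

Section Assembly.
Variables (R : realType) (n L l : nat).
Hypothesis n0 : (0 < n)%N.
Notation V := 'I_n.
Implicit Types (d : automaton n).

Let Dp := (L - 7 * l)%N.
Let F := (2 ^ (10 * l))%N.
Let h := (10 * l + L)%N.
Hypothesis lL : (7 * l + 5 <= L)%N.

Definition small_set_fails d := [exists A : {set V},
  (0 < #|A| <= 2 * 3 ^ 8)%N && (#|nb d A| < 2 * #|A|)%N].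
Definition image_fails d :=
  (n < 2 * l ^ 6 * #|[set run d (nseq L false) p | p : V]|)%N.
(** The mean is of order [l ^ 2 n] per word, so [l ^ 3] leaves a failure probability of order
    [1 / l]; [L ^ 3] in [hitting_fails] does the same for walks of length up to [h]. *)
Definition early_fails d :=
  (F * n * l ^ 3 < \sum_(u : (10 * l).-tuple bool) #|merged d u|)%N.
Definition hitting_fails d :=
  (F * h * n * L ^ 3 < \sum_(u : (10 * l).-tuple bool)
     \sum_(i < h) #|merged d (take i (u ++ nseq L false))|)%N.
Definition late_fails d :=
  (n < \sum_(z : V * V) #|[set uu | @late n (10 * l) L d z uu]|)%N.
Definition level_fails (z : V * V) d i :=
  (alive l i <= size (explore z.1 z.2 d (i + 5)).1)%N &&
  (size (explore z.1 z.2 d (i + 5).+1).1 + loss l (i + 5) <= 2 * alive l i)%N.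
Definition miss_fails (z : V * V) d :=
  let e := (explore z.1 z.2 d Dp).1 in let D := [set v in ends e] in
  [&& (alive l (Dp - 5) <= size e)%N, (F * n <= #|@synced n (10 * l) L d D|)%N &
      all (fun e => (d (e.2.1, false), d (e.2.2, false)) \notin @synced n (10 * l) L d D) e].
Definition pair_fails z d := has (level_fails z d) (iota 0 (Dp - 5)) || miss_fails z d.
Definition some_pair_fails d := [exists z : V * V, (z.1 != z.2) && pair_fails z d].

Definition fails d := [|| small_set_fails d, image_fails d, early_fails d, hitting_fails d,
  late_fails d | some_pair_fails d].

Section Probability.
Hypothesis l0 : (0 < l)%N.

Let nn0 : 0 < n%:R :> R.
Proof. by rewrite ltr0n. Qed.

Lemma Pr_image_fails : Pr R image_fails <=
  (n%:R * (4 / (L%:R + 4)) + (L * (L * L.+1))%:R) / (n%:R / (2 * l ^ 6)%:R).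
Proof.
have c0 : 0 < (2 * l ^ 6)%:R :> R by rewrite ltr0n muln_gt0 expn_gt0 l0.
apply: le_trans (markov_Ex (f := fun d => #|[set run d (nseq L false) p | p : V]|%:R)
  (a := n%:R / (2 * l ^ 6)%:R) _ _ _) _.
- by rewrite divr_gt0.
- by [].
- by move=> d /ltnW; rewrite -(ler_nat R) natrM ler_pdivrMr// mulrC.
by rewrite ler_wpM2r ?invr_ge0 ?divr_ge0//; exact: Ex_image.
Qed.

Lemma Pr_early_fails : Pr R early_fails <=
  (1 + ((10 * l + 10 * l) * (10 * l + 10 * l + 2))%:R) / (l ^ 3)%:R.
Proof.
have F0 : 0 < F%:R :> R by rewrite ltr0n expn_gt0.
have c0 : 0 < (l ^ 3)%:R :> R by rewrite ltr0n expn_gt0 l0.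
apply: le_trans (markov_Ex (f := fun d => (\sum_(u : (10 * l).-tuple bool) #|merged d u|)%N%:R)
  (a := (F * n * l ^ 3)%:R) _ _ _) _.
- by rewrite 2!natrM !mulr_gt0.
- by [].
- by move=> d /ltnW; rewrite ler_nat.
rewrite 2!natrM ler_pdivrMr ?mulr_gt0// div_mul_cancel ?gt_eqF//.
under eq_Ex do rewrite natr_sum.
rewrite Ex_sum -mulrA; apply: (@le_trans _ _ (\sum_(u : (10 * l).-tuple bool) (n%:R * (1 + ((10 * l + 10 * l) * (10 * l + 10 * l + 2))%:R)))).
  by apply: ler_sum => u _; have := Ex_card_merged R n0 u; rewrite size_tuple.
by rewrite sumr_const card_tuple card_bool -[leLHS]mulr_natl.
Qed.

Lemma Pr_hitting_fails : Pr R hitting_fails <=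
  (1 + ((h + h) * (h + h + 2))%:R) / (L ^ 3)%:R.
Proof.
have F0 : 0 < F%:R :> R by rewrite ltr0n expn_gt0.
have L0 : (0 < L)%N by lia.
have h0 : 0 < h%:R :> R by rewrite ltr0n /h addn_gt0 L0 orbT.
have c0 : 0 < (L ^ 3)%:R :> R by rewrite ltr0n expn_gt0 L0.
apply: le_trans (markov_Ex (f := fun d => (\sum_(u : (10 * l).-tuple bool)
     \sum_(i < h) #|merged d (take i (u ++ nseq L false))|)%N%:R)
  (a := (F * h * n * L ^ 3)%:R) _ _ _) _.
- by rewrite 3!natrM !mulr_gt0.
- by [].
- by move=> d /ltnW; rewrite ler_nat.
rewrite 3!natrM ler_pdivrMr ?mulr_gt0// div_mul_cancel ?gt_eqF//.
under eq_Ex do rewrite natr_sum.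
rewrite Ex_sum; apply: (@le_trans _ _ (\sum_(u : (10 * l).-tuple bool)
  \sum_(i < h) (n%:R * (1 + ((h + h) * (h + h + 2))%:R)))).
  apply: ler_sum => u _.
  under eq_Ex do rewrite natr_sum.
  rewrite Ex_sum; apply: ler_sum => i _.
  apply: le_trans (Ex_card_merged R n0 _) _.
  rewrite ler_wpM2l// lerD2l ler_nat.
  have sh : (size (take i (u ++ nseq L false)) <= h)%N.
    by rewrite size_take_min (leq_trans (geq_minl _ _))// ltnW.
  by rewrite leq_mul ?leq_add.
rewrite !sumr_const card_ord card_tuple card_bool -mulrnA -[leLHS]mulr_natl.
by rewrite [(h * _)%:R]natrM [h%:R * _]mulrC !mulrA.
Qed.

Lemma Pr_late_fails : Pr R late_fails <=
  (F ^ 2 * ((4 * h) * (4 * h + 2)) ^ 2)%:R / n%:R.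
Proof.
apply: le_trans (markov_Ex (f := fun d => (\sum_(z : V * V) #|[set uu | @late n (10 * l) L d z uu]|)%N%:R)
  (a := n%:R) _ _ _) _ => //.
- by move=> d /ltnW; rewrite ler_nat.
by rewrite ler_wpM2r ?invr_ge0//; exact: Ex_late.
Qed.

Variables (eps : R) (K : nat).
Hypothesis HK : Pr R small_set_fails <= K%:R / n%:R.
Hypothesis Hlev : forall i, (i < Dp - 5)%N -> exists2 lam : R, 0 <= lam &
  (1 + lam * (8 * 2 ^ (i + 5))%:R / n%:R) ^+ (4 * 2 ^ (i + 5)) / (1 + lam) ^+ loss l (i + 5) <= eps.
Hypothesis Hmiss : (1 - (F * n)%:R / n%:R ^+ 2) ^+ alive l (Dp - 5) <= eps.
Hypothesis Fn : (F * n <= n ^ 2)%N.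

Lemma Pr_some_pair_fails : Pr R some_pair_fails <= n%:R ^+ 2 * ((Dp - 5)%:R * eps + eps).
Proof.
apply: le_trans (Pr_exists _ _ _) _.
have eps0 : 0 <= eps.
  apply: le_trans Hmiss; rewrite exprn_ge0// subr_ge0 ler_pdivrMr ?exprn_gt0//.
  by rewrite mul1r -natrX ler_nat.
have e0 : 0 <= (Dp - 5)%:R * eps + eps by rewrite addr_ge0 ?mulr_ge0.
apply: (@le_trans _ _ (\sum_(z : V * V) ((Dp - 5)%:R * eps + eps))); last first.
  by rewrite sumr_const card_prod card_ord -[leLHS]mulr_natl natrM -expr2.
rewrite big_mkcond; apply: ler_sum => z _; case: ifP => // zz.
apply: le_trans (PrU _ _ _) _; apply: lerD.
  apply: le_trans (Pr_has _ _ (fun i d => level_fails z d i)) _.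
  apply: (@le_trans _ _ (\sum_(i <- iota 0 (Dp - 5)) eps)).
    rewrite big_seq [leRHS]big_seq; apply: ler_sum => i; rewrite mem_iota add0n => iD.
    have [lam lam0] := Hlev iD; apply: le_trans.
    exact: (@Pr_level R n z.1 z.2 zz lam (i + 5) (alive l i) (loss l (i + 5)) lam0).
  by rewrite big_const_seq count_predT size_iota iter_addr_0 mulr_natl.
apply: le_trans Hmiss.
exact: (Pr_miss R zz Dp (alive l (Dp - 5)) Fn (@synced_local n (10 * l) L)).
Qed.

Lemma Pr_fails : Pr R fails <=
  K%:R / n%:R +
  ((n%:R * (4 / (L%:R + 4)) + (L * (L * L.+1))%:R) / (n%:R / (2 * l ^ 6)%:R) +
  ((1 + ((10 * l + 10 * l) * (10 * l + 10 * l + 2))%:R) / (l ^ 3)%:R +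
  ((1 + ((h + h) * (h + h + 2))%:R) / (L ^ 3)%:R +
  ((F ^ 2 * ((4 * h) * (4 * h + 2)) ^ 2)%:R / n%:R +
  n%:R ^+ 2 * ((Dp - 5)%:R * eps + eps))))).
Proof.
apply: le_trans (PrU _ _ _) _; apply: lerD; first exact: HK.
apply: le_trans (PrU _ _ _) _; apply: lerD; first exact: Pr_image_fails.
apply: le_trans (PrU _ _ _) _; apply: lerD; first exact: Pr_early_fails.
apply: le_trans (PrU _ _ _) _; apply: lerD; first exact: Pr_hitting_fails.
apply: le_trans (PrU _ _ _) _; apply: lerD; first exact: Pr_late_fails.
exact: Pr_some_pair_fails.
Qed.

End Probability.

Hypothesis numl : (4 * (F * h * ((L ^ 5) ^ 2 * 2 ^ Dp.+1) + F * h * n * L ^ 3) <= L ^ 5 * (F * n))%N.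
Hypothesis numc : (F * n + F * n * l ^ 3 + n <= l ^ 6 * F * n)%N.
Hypothesis num3 : (3 + Dp + 1 + h <= 3 * L)%N.

Lemma sync_pair d (x y : V) : ~~ fails d ->
  exists w, (size w <= 3 * L)%N /\ run d w x = run d w y.
Proof.
rewrite !negb_or => /and5P[nsm nim nea nhi /andP[nla npa]].
have [->|xy] := eqVneq x y; first by exists [::].
have exp (A : {set V}) : (0 < #|A|)%N -> (#|A| <= 2 * 3 ^ 8)%N -> (2 * #|A| <= #|nb d A|)%N.
  move=> A0 As; rewrite leqNgt; apply: contra nsm => An; apply/existsP; exists A.
  by rewrite A0 As.
have exp1 z : (2 <= #|nb d [set z]|)%N.
  by have := exp [set z]; rewrite cards1; apply.
(* Depth 5 supplies the [2 ^ 5] live pairs from which [alive] starts; the ball of radius [5 + 3]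
   around two states has at most [2 * 3 ^ 8] states, the bound in [small_set_fails]. *)
have [|w0 sw0 [mE|cl]] := @clean_descendant n d x y 5 xy _ (exp1 x) (exp1 y).
- apply: exp.
    apply/card_gt0P; exists x; apply: (fintype.subsetP (sub_iter_nb d _ (leq0n _))).
    by rewrite !inE eqxx.
  by apply: leq_trans (card_iter_nb _ _ _) _; rewrite cards2 xy.
- by exists w0; split=> //; apply: leq_trans sw0 _; lia.
set x' := run d w0 x in cl *; set y' := run d w0 y in cl *.
have xy' : x' != y' by case: cl.
have : ~~ pair_fails (x', y') d.
  by apply: contra npa => pf; apply/existsP; exists (x', y'); rewrite xy'.
rewrite negb_or => /andP[/hasPn nlev nmiss].
have al i : (i <= Dp - 5)%N -> (alive l i <= size (explore x' y' d (i + 5)).1)%N.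
  elim: i => [_|i ih iD]; first by rewrite (explore_clean cl).
  have := nlev i; rewrite mem_iota add0n => /(_ iD).
  rewrite /level_fails ih ?(ltnW iD)//= -ltnNge => lt.
  by rewrite leq_subLR addnC ltnW.
have D5 : (Dp - 5 + 5 = Dp)%N by rewrite /Dp; lia.
have {}al := al _ (leqnn _); rewrite D5 in al.
set e := (explore x' y' d Dp).1 in al.
set D := [set v in ends e].
have [sz se _ _] := explore_inv x' y' d Dp.
have cD : (#|D| <= 2 ^ Dp.+1)%N.
  rewrite cardsE; apply: leq_trans (card_size _) _.
  by rewrite size_ends expnS leq_mul2l.
have L0 : (0 < L ^ 5)%N by rewrite expn_gt0; lia.
have syn : (F * n <= #|@synced n (10 * l) L d D|)%N.
  rewrite -leqNgt in nim; rewrite -leqNgt in nea; rewrite -leqNgt in nhi; rewrite -leqNgt in nla.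
  have := synced_large nim nea nhi nla cD L0 numl.
  move/(leq_trans numc); rewrite !leq_add2r; exact.
move: nmiss; rewrite /miss_fails /= -/e -/D al syn /= => /allPn[f fe].
rewrite negbK !inE => /existsP[u /and3P[_ _ /eqP mE]].
have [s1 f1 f2] := sz f fe.
exists (w0 ++ f.1 ++ false :: (u ++ nseq L false)); split.
  rewrite size_cat size_cat /= size_cat size_tuple size_nseq s1.
  by apply: leq_trans num3; rewrite -/h; move: (h) => h'; rewrite -!addnA leq_add.
by rewrite !(run_cat _ _ w0) !(run_cat _ _ f.1) f1 f2.
Qed.

End Assembly.

(** * Numerical bounds *)

(** Relative to [2 ^ i], one starts from 32; losses of 8 at every depth remove less than 8, and the
    growing part of [loss] removes at most [2 i / 2 ^ l < 2]. *)
Lemma leq_alive l i : (i < 2 ^ l)%N -> (2 ^ (i + 4) <= alive l i)%N.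
Proof.
move=> il; set A := (2 ^ l)%N in il *.
have key : (16 * A * (32 * 2 ^ i + 8) <= 16 * A * alive l i + 16 * A * (8 * 2 ^ i) + i * (32 * 2 ^ i))%N.
  elim: i {il} => [|i ih]; first by rewrite /= expn0 !muln1 mul0n addn0; lia.
  have lo : (16 * A * loss l (i + 5) <= 16 * A * 8 + 64 * 2 ^ i)%N.
    rewrite /loss; have [h|h] := leqP (l + 3) (i + 5).
      have := subnK h; set s := (i + 5 - (l + 3))%N => E.
      have : (2 ^ s * 2 ^ (l + 3) = 2 ^ (i + 5))%N by rewrite -expnD E.
      by rewrite !expnD -/A; lia.
    by rewrite (eqP (ltnW h : _ == _)) expn0; lia.
  have st : (2 * alive l i <= alive l i.+1 + loss l (i + 5))%N by rewrite /=; lia.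
  have := leq_mul (leqnn (16 * A)%N) st; rewrite expnS.
  by move: (alive l i.+1) (loss l (i + 5)) lo => a' lo' lo; nia.
rewrite expnD; have A0 : (0 < A)%N by rewrite expn_gt0.
rewrite -(leq_pmul2l A0).
have : (i * (32 * 2 ^ i) <= A * (32 * 2 ^ i))%N by rewrite leq_mul2r ltnW ?orbT.
by move: (alive l i) key; move: (2 ^ i)%N => p a; nia.
Qed.

Lemma pow8 l : (64 <= l)%N -> (16 * l ^ 8 <= 2 ^ l.-1)%N.
Proof.
move=> l64; have l0 : (0 < l)%N by apply: leq_trans l64.
set t := trunc_log 2 l.
have tl : (2 ^ t <= l)%N by apply: trunc_logP.
have lt : (l < 2 ^ t.+1)%N by apply: trunc_log_ltn.
have t6 : (6 <= t)%N by apply: trunc_log_max.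
(* It starts to hold at [t = 6], as [61 <= 64]: hence the threshold 64 on [l]. *)
have pt : (8 * t + 13 <= 2 ^ t)%N.
  by move: t6; elim: (t) => // s ih; rewrite leq_eqVlt ltnS => /orP[/eqP<-//|/ih]; rewrite expnS; lia.
apply: (@leq_trans (2 ^ 4 * (2 ^ t.+1) ^ 8)).
  by rewrite leq_mul2l leq_exp2r// ltnW.
by rewrite -expnM -expnD leq_pexp2l//; lia.
Qed.

Lemma expR1_le4 (R : realType) : expR 1 <= 4 :> R.
Proof.
have -> : 1 = - (- 2^-1) + - (- 2^-1) :> R by lra.
rewrite expRD expRN; have := expR_ge1Dx (- 2^-1 : R); set s := expR _ => hs.
have s2 : 2^-1 <= s by lra.
have s0 : 0 < s by lra.
have hi : s^-1 <= 2 by rewrite -[leRHS]invrK lef_pV2 ?posrE.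
have i0 : 0 <= s^-1 by rewrite invr_ge0 ltW.
by nra.
Qed.

Lemma expR1_ge2 (R : realType) : 2 <= expR 1 :> R.
Proof. by have := expR_ge1Dx (1 : R); rewrite (_ : 1 + 1 = 2)//; lra. Qed.

Lemma pow1D_le (R : realType) (x : R) (m N : nat) : 0 <= x -> x * N%:R <= m%:R ->
  (1 + x) ^+ N <= 4 ^+ m.
Proof.
move=> x0 xN; apply: (@le_trans _ _ (expR x ^+ N)).
  by rewrite lerXn2r ?nnegrE ?expR_ge0 ?addr_ge0// expR_ge1Dx.
rewrite -expRM_natl mulrC; apply: (@le_trans _ _ (expR (m%:R * 1))).
  by rewrite ler_expR mulr1.
by rewrite expRM_natl lerXn2r ?nnegrE ?expR_ge0// expR1_le4.
Qed.

Lemma pow1B_le (R : realType) (x : R) (m N : nat) : 0 <= x <= 1 -> m%:R <= x * N%:R ->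
  (1 - x) ^+ N <= (2 ^+ m)^-1.
Proof.
move=> /andP[x0 x1] mx; apply: (@le_trans _ _ (expR (- x) ^+ N)).
  by rewrite lerXn2r ?nnegrE ?expR_ge0 ?subr_ge0// expR_ge1Dx.
rewrite -expRM_natl mulrN mulrC expRN lef_pV2 ?posrE ?expR_gt0 ?exprn_gt0//.
apply: (@le_trans _ _ (expR (m%:R * 1))); last by rewrite ler_expR mulr1.
by rewrite expRM_natl lerXn2r ?nnegrE ?expR_ge0// expR1_ge2.
Qed.

Section Numerics.
Variables (L l : nat).
Hypothesis l64 : (64 <= l)%N.
Hypothesis lL : (2 ^ l.-1 <= L)%N.

Lemma l8L : (16 * l ^ 8 <= L)%N.
Proof. exact: leq_trans (pow8 l64) lL. Qed.

Lemma l7L : (1024 * l ^ 7 <= L)%N.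
Proof.
apply: leq_trans l8L; rewrite [(l ^ 8)%N]expnS mulnA leq_mul2r.
by apply/orP; right; lia.
Qed.

Lemma lL1024 : (1024 * l <= L)%N.
Proof.
apply: leq_trans l7L; rewrite leq_mul2l /= -{1}[l]expn1 leq_pexp2l//.
exact: leq_trans l64.
Qed.

Variable n : nat.
Hypothesis Ll : (L < 2 ^ l)%N.
Hypothesis Ln : (2 ^ L <= n)%N.
Hypothesis nL : (n < 2 ^ L.+1)%N.

Let Dp := (L - 7 * l)%N.
Let F := (2 ^ (10 * l))%N.
Let h := (10 * l + L)%N.

Lemma num_Fn : (F <= n)%N.
Proof.
apply: leq_trans Ln; rewrite leq_pexp2l//.
by have := lL1024; lia.
Qed.

(** After division by [F n] both terms are of order [L ^ 4], against [L ^ 5]. For the first this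
    uses [L ^ 7 * 2 ^ Dp <= n], which the depth [L - 7 l] provides. *)
Lemma num_hitting :
  (4 * (F * h * ((L ^ 5) ^ 2 * 2 ^ Dp.+1) + F * h * n * L ^ 3) <= L ^ 5 * (F * n))%N.
Proof.
have hL := lL1024.
have LD : (L ^ 7 * 2 ^ Dp <= n)%N.
  apply: leq_trans Ln; apply: (@leq_trans ((2 ^ l) ^ 7 * 2 ^ Dp)).
    by rewrite leq_mul2r leq_exp2r ?(ltnW Ll) ?orbT.
  by rewrite -expnM -expnD leq_pexp2l// /Dp; lia.
have h2 : (h <= 2 * L)%N by rewrite /h; lia.
have L24 : (24 <= L)%N by lia.
have -> : ((L ^ 5) ^ 2 * 2 ^ Dp.+1 = 2 * L ^ 3 * (L ^ 7 * 2 ^ Dp))%N.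
  by rewrite -expnM [(2 ^ Dp.+1)%N]expnS (_ : (5 * 2 = 3 + 7)%N)// expnD; ring.
apply: (@leq_trans (4 * (F * h * (2 * L ^ 3 * n) + F * h * n * L ^ 3))).
  by rewrite leq_mul2l leq_add2r leq_mul2l leq_mul2l LD !orbT.
have -> : (4 * (F * h * (2 * L ^ 3 * n) + F * h * n * L ^ 3) = 12 * h * (L ^ 3 * (F * n)))%N by ring.
have -> : (L ^ 5 * (F * n) = L * L * (L ^ 3 * (F * n)))%N by rewrite (_ : 5 = 2 + 3)%N// expnD; ring.
rewrite leq_mul2r; apply/orP; right.
apply: (@leq_trans (24 * L)); first by lia.
by rewrite leq_mul2r L24 orbT.
Qed.

Lemma num_cluster : (F * n + F * n * l ^ 3 + n <= l ^ 6 * F * n)%N.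
Proof.
have F1 : (1 <= F)%N by rewrite expn_gt0.
have l3 : (2 <= l ^ 3)%N.
  by apply: (@leq_trans (l ^ 1)); [rewrite expn1; lia|rewrite leq_pexp2l//; lia].
have -> : (l ^ 6 * F * n = l ^ 3 * l ^ 3 * (F * n))%N by rewrite -expnD mulnA.
have nF : (n <= F * n)%N by rewrite leq_pmull.
by move: (F * n)%N (l ^ 3)%N nF l3 => a b nF l3; nia.
Qed.

Lemma num_length : (3 + Dp + 1 + h <= 3 * L)%N.
Proof. by have := lL1024; rewrite /Dp /h; lia. Qed.

Lemma num_dom : (7 * l + 5 <= L)%N.
Proof. by have := lL1024; lia. Qed.

(** As [L < 2 ^ l], polynomials in [L] and [2 ^ l] are compared with [n] by counting exponents. *)
Lemma num_pow a b : (a + b * l <= 1024 * l)%N -> (2 ^ a * (2 ^ l) ^ b <= n)%N.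
Proof.
move=> ab; apply: leq_trans Ln; rewrite -expnM -expnD leq_pexp2l//.
by rewrite [(l * b)%N]mulnC (leq_trans ab)// lL1024.
Qed.

Variable R : realType.
(** Sized for a union bound over fewer than [2 ^ (2 L + 2)] pairs and at most [L] events for
    each. *)
Let eps : R := (2 ^+ (3 * L + 2))^-1.

Let nn0 : 0 < n%:R :> R.
Proof. by rewrite ltr0n (leq_trans _ Ln)// expn_gt0. Qed.

Lemma num_levels i : (i < Dp - 5)%N -> exists2 lam : R, 0 <= lam &
  (1 + lam * (8 * 2 ^ (i + 5))%:R / n%:R) ^+ (4 * 2 ^ (i + 5)) / (1 + lam) ^+ loss l (i + 5) <= eps.
Proof.
have hL := lL1024.
set j := (i + 5)%N => iD; have jD : (j < Dp)%N by rewrite /j; lia.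
have p0 : 0 < (2 ^ j)%:R :> R by rewrite ltr0n expn_gt0.
(* At shallow depth the mean number of repeats, of order [4 ^ j / n], is tiny, and [lam] is tuned so
   that the moment is at most 4. Then [lam >= 2 ^ (L - 5 - 2 j)], of order at least [2 ^ (L / 2)],
   and seven such factors exceed [2 ^ (3 L + 4)]: hence the 7 in [loss]. *)
have [j4|j4] := leqP (4 * j) L.
  exists (n%:R / (32 * 2 ^ j * 2 ^ j)%:R); first by rewrite divr_ge0.
  set lam := _ / _.
  have q0 : 0 < (32 * 2 ^ j * 2 ^ j)%:R :> R by rewrite ltr0n !muln_gt0 expn_gt0.
  have lam0 : 0 <= lam by rewrite divr_ge0.
  have num : (1 + lam * (8 * 2 ^ j)%:R / n%:R) ^+ (4 * 2 ^ j) <= 4 ^+ 1.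
    apply: pow1D_le; first by rewrite !mulr_ge0 ?invr_ge0 ?(ltW nn0).
    rewrite /lam !natrM le_eqVlt; apply/orP; left; apply/eqP.
    by field; rewrite !gt_eqF.
  have lamb : (2 ^ (L - (5 + 2 * j)))%:R <= lam.
    rewrite ler_pdivlMr// -natrM ler_nat; apply: leq_trans Ln.
    rewrite -[32%N]/(2 ^ 5)%N -!expnD leq_pexp2l//; lia.
  have den : 2 ^+ (3 * L + 4) <= (1 + lam) ^+ loss l j.
    apply: (@le_trans _ _ ((1 + lam) ^+ 7)); last first.
      by apply: ler_weXn2l; rewrite ?lerDl// /loss leq_addr.
    apply: (@le_trans _ _ (lam ^+ 7)); last by rewrite lerXn2r ?nnegrE ?addr_ge0// lerDr.
    apply: (@le_trans _ _ ((2 ^ (L - (5 + 2 * j)))%:R ^+ 7)); last by rewrite lerXn2r ?nnegrE.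
    rewrite natrX -exprM; apply: ler_weXn2l; first by rewrite ler1n.
    by lia.
  rewrite ler_pdivrMr; last by apply: lt_le_trans den; rewrite exprn_gt0.
  apply: le_trans num _; rewrite /eps mulrC ler_pdivlMr ?exprn_gt0//.
  apply: le_trans den; rewrite expr1 (_ : 4 = 2 ^+ 2); last by rewrite expr2; ring.
  by rewrite -exprD; apply: ler_weXn2l; [rewrite ler1n|lia].
(* At large depth the allowed losses, of order [2 ^ (j - l)], exceed both [3 L] and the mean number
   of repeats, at most of order [2 ^ (j - 7 l)], so a constant [lam] is enough. *)
exists 1; first exact: ler01.
have num : (1 + 1 * (8 * 2 ^ j)%:R / n%:R) ^+ (4 * 2 ^ j) <= 4 ^+ (2 ^ (j + 5 - 7 * l)) :> R.
  apply: pow1D_le; first by rewrite mul1r divr_ge0.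
  rewrite mul1r mulrAC -natrM ler_pdivrMr// -natrM ler_nat.
  apply: (@leq_trans (2 ^ (j + 5 - 7 * l) * 2 ^ L)); last by rewrite leq_mul2l Ln orbT.
  have -> : (8 * 2 ^ j * (4 * 2 ^ j) = 2 ^ 5 * 2 ^ j * 2 ^ j)%N by rewrite -[(2 ^ 5)%N]/32%N; ring.
  by rewrite -!expnD leq_pexp2l//; rewrite /Dp in jD; lia.
have den : (1 + 1 : R) ^+ loss l j = 2 ^+ loss l j by congr (_ ^+ _); ring.
rewrite den ler_pdivrMr ?exprn_gt0//; apply: le_trans num _.
rewrite /eps mulrC ler_pdivlMr ?exprn_gt0// (_ : 4 = 2 ^+ 2); last by rewrite expr2; ring.
rewrite -exprM -exprD; apply: ler_weXn2l; first by rewrite ler1n.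
rewrite /loss; set s := (j - (l + 4))%N.
have sl : (2 ^ (l + 2) <= 2 ^ s)%N by rewrite leq_pexp2l// /s; lia.
have -> : (j - (l + 3) = s.+1)%N by rewrite /s; lia.
have lo : (2 * 2 ^ (j + 5 - 7 * l) <= 2 ^ s)%N by rewrite -expnS leq_pexp2l// /s; lia.
rewrite expnS; move: sl; rewrite expnD -[(2 ^ 2)%N]/4%N.
by move: lo Ll; move: (2 ^ (j + 5 - 7 * l))%N (2 ^ s)%N (2 ^ l)%N => a b c; lia.
Qed.

(** At least [2 ^ (3 l - 2)] hits are expected, the margin left between [10 l] and [7 l]; this
    exceeds [3 L + 2]. *)
Lemma num_miss : (1 - (F * n)%:R / n%:R ^+ 2) ^+ alive l (Dp - 5) <= eps.
Proof.
have hL := lL1024.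
have -> : (F * n)%:R / n%:R ^+ 2 = F%:R / n%:R :> R.
  by rewrite natrM expr2 invfM mulrA mulfK// gt_eqF.
have Fx : 0 <= (F%:R / n%:R : R) <= 1.
  by rewrite divr_ge0//= ler_pdivrMr// mul1r ler_nat num_Fn.
apply: le_trans (pow1B_le (m := 2 ^ (3 * l - 2)) Fx _) _.
  apply: (@le_trans _ _ (F%:R / n%:R * (2 ^ (Dp - 5 + 4))%:R)).
    rewrite mulrAC ler_pdivlMr// -!natrM ler_nat.
    apply: (@leq_trans (2 ^ (3 * l - 2) * 2 ^ L.+1)); first by rewrite leq_mul2l (ltnW nL) orbT.
    by rewrite /F -!expnD leq_pexp2l// /Dp; lia.
  rewrite ler_wpM2l ?divr_ge0// ler_nat leq_alive//.
  by apply: leq_trans Ll; rewrite ltnS /Dp; lia.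
rewrite /eps lef_pV2 ?posrE ?exprn_gt0//; apply: ler_weXn2l; first by rewrite ler1n.
have : (2 ^ (l + 2) <= 2 ^ (3 * l - 2))%N by rewrite leq_pexp2l//; lia.
by rewrite expnD -[(2 ^ 2)%N]/4%N; move: Ll; lia.
Qed.

End Numerics.

Local Open Scope classical_set_scope.
Local Open Scope ring_scope.

(** * Sum of the failure probabilities *)

Section Total.
Variables (R : realType) (n L l K : nat).
Hypothesis l64 : (64 <= l)%N.
Hypothesis lL : (2 ^ l.-1 <= L)%N.
Hypothesis Ll : (L < 2 ^ l)%N.
Hypothesis Ln : (2 ^ L <= n)%N.
Hypothesis nL : (n < 2 ^ L.+1)%N.
Hypothesis Kl : (K <= l)%N.

Let Dp := (L - 7 * l)%N.
Let F := (2 ^ (10 * l))%N.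
Let h := (10 * l + L)%N.

Let nn0 : 0 < n%:R :> R.
Proof. by rewrite ltr0n (leq_trans _ Ln)// expn_gt0. Qed.
Let ll0 : 0 < l%:R :> R.
Proof. by rewrite ltr0n (leq_trans _ l64). Qed.
Let hL := lL1024 l64 lL.

Let frac (a b c : nat) : (0 < a)%N -> (b * l <= c * a)%N ->
  b%:R / a%:R <= c%:R / l%:R :> R.
Proof.
move=> a0 bl; rewrite ler_pdivrMr ?ltr0n// mulrAC ler_pdivlMr//.
by rewrite -!natrM ler_nat.
Qed.

Let l2l : (l < 2 ^ l)%N. Proof. exact: ltn_expl. Qed.

Let bnd_small : K%:R / n%:R <= 1%:R / l%:R :> R.
Proof.
apply: frac; first by rewrite -(ltr0n R).
rewrite mul1n; apply: leq_trans (num_pow l64 lL Ln (a := 0) (b := 2) _); last by lia.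
by rewrite expn0 mul1n expnS expn1 leq_mul// ltnW// (leq_ltn_trans Kl).
Qed.

Let bnd_image : (n%:R * (4 / (L%:R + 4)) + (L * (L * L.+1))%:R) / (n%:R / (2 * l ^ 6)%:R)
  <= 2%:R / l%:R :> R.
Proof.
have -> : (n%:R * (4 / (L%:R + 4)) + (L * (L * L.+1))%:R) / (n%:R / (2 * l ^ 6)%:R) =
   (8 * l ^ 6)%:R / (L + 4)%:R + (L * (L * L.+1) * (2 * l ^ 6))%:R / n%:R :> R.
  rewrite !natrM natrD; field.
  by rewrite !gt_eqF ?ltr_wpDl.
rewrite (natrD R 1 1) mulrDl; apply: lerD; apply: frac.
- by rewrite addn_gt0 orbT.
- rewrite mul1n -mulnA -expnSr; apply: leq_trans (leq_addr _ _).
  by apply: leq_trans (l7L l64 lL); rewrite leq_mul2r orbT.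
- by rewrite -(ltr0n R).
rewrite mul1n; apply: leq_trans (num_pow l64 lL Ln (a := 2) (b := 4) _); last by lia.
have l7 : (l ^ 7 <= L)%N by apply: leq_trans (l7L l64 lL); rewrite leq_pmull.
apply: (@leq_trans (4 * L ^ 4)).
  rewrite mulnA -mulnA [(l ^ 6 * l)%N]mulnC -expnS.
  have L1 : (1 <= L)%N by lia.
  apply: (@leq_trans (L * (L * L.+1) * 2 * L)); first by rewrite leq_mul2l l7 orbT.
  rewrite !expnS expn0; nia.
by rewrite leq_mul2l leq_exp2r ?(ltnW Ll).
Qed.

(** The dominant term: [20 l (20 l + 2) + 1 <= (400 + 40 + 1) l ^ 2]. *)
Let bnd_early : (1 + ((10 * l + 10 * l) * (10 * l + 10 * l + 2))%:R) / (l ^ 3)%:R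
  <= 441%:R / l%:R :> R.
Proof.
rewrite (_ : 1 + _ = (1 + (10 * l + 10 * l) * (10 * l + 10 * l + 2))%:R); last by rewrite natrD.
apply: frac; first by rewrite expn_gt0; lia.
by rewrite [(l ^ 3)%N]expnSr mulnA leq_mul2r; apply/orP; right; rewrite expnS expn1; nia.
Qed.

Let bnd_hitting : (1 + ((h + h) * (h + h + 2))%:R) / (L ^ 3)%:R <= 1%:R / l%:R :> R.
Proof.
rewrite (_ : 1 + _ = (1 + (h + h) * (h + h + 2))%:R); last by rewrite natrD.
have h2 : (h <= 2 * L)%N by rewrite /h; lia.
apply: frac; first by rewrite expn_gt0; lia.
rewrite mul1n; apply: (@leq_trans (25 * (L * L) * l)).
  by rewrite leq_mul2r; apply/orP; right; move: (h) h2 => h' h2; nia.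
by rewrite !expnS expn0 muln1; nia.
Qed.

Let bnd_late : (F ^ 2 * ((4 * h) * (4 * h + 2)) ^ 2)%:R / n%:R <= 1%:R / l%:R :> R.
Proof.
have h2 : (h <= 2 * L)%N by rewrite /h; lia.
apply: frac; first by rewrite -(ltr0n R).
rewrite mul1n; apply: leq_trans (num_pow l64 lL Ln (a := 14) (b := 25) _); last by lia.
have hh : ((4 * h) * (4 * h + 2) <= 2 ^ 7 * (L * L))%N.
  by rewrite -[(2 ^ 7)%N]/128%N; move: (h) h2 => h' h2; nia.
have FE : (F ^ 2 = (2 ^ l) ^ 20)%N.
  by rewrite /F -!expnM; congr (_ ^ _)%N; lia.
have LL : (L * L <= (2 ^ l) ^ 2)%N by rewrite expnS expn1 leq_mul// ltnW.
have hh2 : (((4 * h) * (4 * h + 2)) ^ 2 <= (2 ^ 7 * (2 ^ l) ^ 2) ^ 2)%N.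
  by rewrite leq_exp2r// (leq_trans hh)// leq_mul2l LL orbT.
apply: (@leq_trans ((2 ^ l) ^ 20 * (2 ^ 7 * (2 ^ l) ^ 2) ^ 2 * 2 ^ l)).
  by rewrite FE leq_mul ?leq_mul2l ?hh2 ?orbT// ltnW.
have -> : (2 ^ 14 = (2 ^ 7) ^ 2)%N by rewrite -expnM.
rewrite (_ : 25 = 20 + 2 * 2 + 1)%N// !expnD expn1 expnMn.
by move: (2 ^ 7)%N (2 ^ l)%N => a b; rewrite leq_eqVlt; apply/orP; left; apply/eqP; rewrite [(b ^ (2 * 2))%N]expnM; ring.
Qed.

Let bnd_pair : n%:R ^+ 2 * ((Dp - 5)%:R * (2 ^+ (3 * L + 2))^-1 + (2 ^+ (3 * L + 2))^-1)
  <= 1%:R / l%:R :> R.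
Proof.
rewrite -[X in _ + X]mul1r -mulrDl mulrA -(natrD R _ 1) -!natrX -natrM.
apply: frac; first by rewrite expn_gt0.
rewrite mul1n; apply: (@leq_trans ((2 ^ L.+1) ^ 2 * 2 ^ L)); last first.
  by rewrite -expnM -expnD leq_pexp2l//; lia.
rewrite -mulnA leq_mul//; first by rewrite leq_exp2r// ltnW.
apply: (@leq_trans (L * L)); first by apply: leq_mul; rewrite /Dp; lia.
apply: (@leq_trans ((2 ^ l) ^ 2)); first by rewrite expnS expn1 leq_mul// ltnW.
by rewrite -expnM leq_pexp2l//; lia.
Qed.

Lemma Pr_fails_le : Pr R (small_set_fails (n := n)) <= K%:R / n%:R ->
  Pr R (fails (n := n) L l) <= 447%:R / l%:R.
Proof.
move=> HK; have n0 : (0 < n)%N by rewrite -(ltr0n R).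
have l0 : (0 < l)%N by apply: leq_trans l64.
apply: le_trans (Pr_fails n0 (num_dom l64 lL Ll Ln nL) l0 HK
  (num_levels l64 lL Ll Ln nL R) (num_miss l64 lL Ll Ln nL R) _) _.
  by rewrite -mulnn leq_mul2r (num_Fn l64 lL Ll Ln nL) orbT.
have -> : 447%:R / l%:R = 1%:R / l%:R + (2%:R / l%:R + (441%:R / l%:R +
    (1%:R / l%:R + (1%:R / l%:R + 1%:R / l%:R)))) :> R.
  by rewrite -!mulrDl -!natrD.
exact: lerD bnd_small (lerD bnd_image (lerD bnd_early (lerD bnd_hitting (lerD bnd_late bnd_pair)))).
Qed.

End Total.

(** * Convergence of the probability *)

Lemma Pr_small_set_fails (R : realType) : exists K : nat, forall n, (0 < n)%N ->
  Pr R (small_set_fails (n := n)) <= K%:R / n%:R.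
Proof. by eexists => n n0; exact: Pr_not_expanding. Qed.

Lemma prob_uniform_Pr (R : realType) (T : finType) (E : T -> Prop) (bad : pred T) :
  (0 < #|T|)%N -> (forall t, ~~ bad t -> E t) -> `|1 - prob_uniform_fin R E| <= Pr R bad.
Proof.
move=> T0 badE; set good := [pred t : T | `[< E t >]].
have T0R : 0 < #|T|%:R :> R by rewrite ltr0n.
have -> : 1 - prob_uniform_fin R E = #|[predC good]|%:R / #|T|%:R.
  apply: (mulIf (lt0r_neq0 T0R)); rewrite mulrBl mul1r !divfK ?gt_eqF//.
  by rewrite -[in X in X - _](cardC good) natrD addrC addKr.
rewrite ger0_norm ?divr_ge0// PrE ler_wpM2r ?invr_ge0// ler_nat.
apply/subset_leq_card/fintype.subsetP => t; rewrite !inE /=.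
by apply: contraR => /badE/asboolP.
Qed.

Theorem theorem1p3 (R : realType) :
  (fun n : nat =>
     prob_uniform_fin R (fun delta : automaton n =>
       forall x y : 'I_n, exists w : word,
         (size w)%:R <= 3 * log2 (n%:R : R) /\ run delta w x = run delta w y))
    @ \oo --> (1 : R).
Proof.
have [K HK] := Pr_small_set_fails R.
apply/cvgrPdist_le => e e0.
have [l1 [l1_64 l1K l1e]] : exists l1 : nat, [/\ (64 <= l1)%N, (K <= l1)%N & 447%:R / e <= l1%:R].
  exists (maxn 64 (maxn K (Num.truncn (447%:R / e)).+1)); split; rewrite ?leq_max ?leqnn ?orbT//.
  apply: le_trans (ltW (truncnS_gt _)) _.
  by rewrite ler_nat !leq_max leqnn !orbT.
near=> n.
(* The error is [447 / l] with [l] a twice iterated logarithm of [n], so the threshold is doubly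
   exponential. *)
have nbig : (2 ^ 2 ^ l1 <= n)%N by near: n; exact: nbhs_infty_ge.
have n0 : (0 < n)%N by rewrite (leq_trans _ nbig)// expn_gt0.
set L := trunc_log 2 n.
have Ln : (2 ^ L <= n)%N by rewrite trunc_logP.
have nL : (n < 2 ^ L.+1)%N by rewrite trunc_log_ltn.
have lL1 : (2 ^ l1 <= L)%N by rewrite trunc_log_max.
have L0 : (0 < L)%N by rewrite (leq_trans _ lL1)// expn_gt0.
set l := (trunc_log 2 L).+1.
have lL : (2 ^ l.-1 <= L)%N by rewrite trunc_logP.
have Ll : (L < 2 ^ l)%N by rewrite trunc_log_ltn.
have l1l : (l1 <= l)%N by rewrite ltnW// ltnS trunc_log_max.
have l64 : (64 <= l)%N by exact: leq_trans l1l.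
have T0 : (0 < #|automaton n|)%N.
  by rewrite card_ffun card_ord expn_gt0 n0.
apply: le_trans (prob_uniform_Pr R (bad := fails L l) T0 _) _.
  move=> d good x y.
  have [w [wL wxy]] := sync_pair n0 (num_dom l64 lL Ll Ln nL) (num_hitting l64 lL Ll Ln nL)
    (num_cluster l64 lL Ll Ln nL) (num_length l64 lL Ll Ln nL) x y good.
  exists w; split => //.
  have ln2 : 0 < ln 2 :> R by rewrite ln_gt0// ltr1n.
  apply: (@le_trans _ _ (3 * L%:R)); first by rewrite -natrM ler_nat.
  rewrite ler_wpM2l// /log2 ler_pdivlMr// mulr_natl -lnXn//.
  by rewrite ler_ln ?posrE ?exprn_gt0 ?ltr0n// -natrX ler_nat.
apply: le_trans (Pr_fails_le l64 lL Ll Ln nL (leq_trans l1K l1l) (HK n n0)) _.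
rewrite ler_pdivrMr ?ltr0n ?(leq_trans _ l64)//.
rewrite mulrC -ler_pdivrMr//; apply: le_trans l1e _.
by rewrite ler_nat.
Unshelve. all: by end_near.
Qed.
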